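(* Let $X$ be a Fano manifold and let $g$ be a Kähler metric on $X$ that is both an extremal Kähler metric and a Kähler--Ricci soliton. Then $g$ is Kähler--Einstein, i.e. $\mathrm{Ric}(\omega_g)=\omega_g$.
   Context: A Fano manifold is a connected compact complex manifold $X$ (of complex dimension $n$, with complex structure $J$) whose first Chern class $c_1(X)$ is represented by a Kähler form. For a Kähler metric $g$ on $X$, the Kähler form is normalized by $\omega_g(V,W)=\frac{1}{2\pi}g(JV,W)$. $\mathrm{Ric}(\omega_g)$ denotes the Ricci form normalized so that it represents $c_1(X)$, locally $\mathrm{Ric}(\omega_g)=-\frac{\sqrt{-1}}{2\pi}\partial\bar\partial\log\det(g_{i\bar j})$, and $s(\omega_g)$ denotes the scalar curvature of $g$. For $u\in C^\infty(X,\mathbf{C})$, $\mathrm{grad}^{\mathbf{C}}_{\omega_g}u$ denotes the $(1,0)$-part of the gradient $\mathrm{grad}_g u$; in local holomorphic coordinates it is $\nabla^i u\,\frac{\partial}{\partial z^i}$, and it satisfies $i_{\mathrm{grad}^{\mathbf{C}}_{\omega_g}u}\,\omega_g=\frac{\sqrt{-1}}{2\pi}\bar\partial u$. A Kähler metric $g$ is extremal if $\mathrm{grad}^{\mathbf{C}}_{\omega_g}s(\omega_g)$ is a holomorphic vector field on $X$. A Kähler metric $g$ is a Kähler--Ricci soliton if there exists a holomorphic vector field $V$ on $X$ such that $\mathrm{Ric}(\omega_g)-\omega_g=L_V\omega_g$, where $L_V$ is the Lie derivative (in particular $\omega_g$ represents $c_1(X)$). Equivalently, $\omega_g$ represents $c_1(X)$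 and $\mathrm{grad}^{\mathbf{C}}_{\omega_g}F_g$ is a holomorphic vector field, where the Ricci potential $F_g\in C^\infty(X,\mathbf{R})$ is the unique real function with $\mathrm{Ric}(\omega_g)-\omega_g=\frac{\sqrt{-1}}{2\pi}\partial\bar\partial F_g$ and $\int_X(1-e^{F_g})\,\omega_g^n=0$. *)

(* Defs.v *)
From HB Require Import structures.
From mathcomp Require Import all_boot all_order all_algebra.
From mathcomp Require Import complex.
From mathcomp Require Import all_classical all_reals all_analysis.

Set Implicit Arguments.
Unset Strict Implicit.
Unset Printing Implicit Defensive.

Import Order.TTheory GRing.Theory Num.Theory.
Import numFieldNormedType.Exports.

Local Open Scope classical_set_scope.
Local Open Scope ring_scope.

(* C^n as the real normed space R^n * R^n: (x, y) stands for x + iy, so that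
   derivatives are real derivatives and smooth need not mean holomorphic. *)
Definition Cn (R : realType) (n : nat) : normedModType R :=
  ('rV[R]_n * 'rV[R]_n)%type.

(* inl i is the index i and inr i the barred index of z^i; sums and equations
   over this type range over dz^1, ..., dz^n, dzbar^1, ..., dzbar^n. *)
Definition idx (n : nat) := ('I_n + 'I_n)%type.

Section Calculus.
Variables (R : realType) (n : nat).
Implicit Types (U : set (Cn R n)) (A B : idx n).

Fixpoint Ck (k : nat) U (f : Cn R n -> R) : Prop :=
  (forall z, U z -> {for z, continuous f}) /\
  (if k is k'.+1 then
     forall v : Cn R n,
       (forall z, U z -> derivable f z v) /\ Ck k' U ('D_v f)
   else True).

(* C^oo, for U open *)
Definition smooth U (f : Cn R n -> R[i]) : Prop :=
  forall k, Ck k U (fun z => complex.Re (f z)) /\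
            Ck k U (fun z => complex.Im (f z)).

Definition cderive (v : Cn R n) (f : Cn R n -> R[i]) (z : Cn R n) : R[i] :=
  Complex ('D_v (fun w => complex.Re (f w)) z)
          ('D_v (fun w => complex.Im (f w)) z).

Definition ex (i : 'I_n) : Cn R n := (delta_mx 0 i, 0).
Definition ey (i : 'I_n) : Cn R n := (0, delta_mx 0 i).

(* Wirtinger operators d/dz^i = (d/dx^i - i d/dy^i)/2 and
   d/dzbar^i = (d/dx^i + i d/dy^i)/2 *)
Definition pd A (f : Cn R n -> R[i]) (z : Cn R n) : R[i] :=
  match A with
  | inl i => (cderive (ex i) f z - 'i * cderive (ey i) f z) / 2
  | inr i => (cderive (ex i) f z + 'i * cderive (ey i) f z) / 2
  end.

Definition holomorphic U (f : Cn R n -> R[i]) : Prop :=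
  smooth U f /\ forall j z, U z -> pd (inr j) f z = 0.

Definition zcoord A (z : Cn R n) : R[i] :=
  match A with
  | inl i => Complex (z.1 0 i) (z.2 0 i)
  | inr i => Complex (z.1 0 i) (- z.2 0 i)
  end.

End Calculus.

Record complexManifold (R : realType) (n : nat) := ComplexManifold {
  carrier :> topologicalType;
  chart : Type;
  cdom : chart -> set carrier;
  cmap : chart -> carrier -> Cn R n;
  cinv : chart -> Cn R n -> carrier;
  manifold_hausdorff : hausdorff_space carrier;
  manifold_second_countable : @second_countable carrier;
  cdom_cover : forall x, exists a, cdom a x;
  cdom_open : forall a, open (cdom a);
  crange_open : forall a, open (cmap a @` cdom a);
  cmapK : forall a x, cdom a x -> cinv a (cmap a x) = x;
  cmap_continuous : forall a x, cdom a x -> {for x, continuous (cmap a)};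
  cinv_continuous : forall a z, (cmap a @` cdom a) z ->
    {for z, continuous (cinv a)};
  transition_holomorphic : forall a b (i : 'I_n),
    holomorphic (cmap a @` (cdom a `&` cdom b))
      (fun z => zcoord (inl i) (cmap b (cinv a z)))
}.

Section ComplexGeometry.
Variables (R : realType) (n : nat) (X : complexManifold R n).
Implicit Types (a b : chart X) (z : Cn R n) (A B C : idx n).

Definition crange a : set (Cn R n) := @cmap R n X a @` @cdom R n X a.
Definition overlap a b : set (Cn R n) :=
  @cmap R n X a @` (@cdom R n X a `&` @cdom R n X b).
Definition transition a b : Cn R n -> Cn R n := fun z => cmap b (cinv a z).

(* d w^B / d z^A, where z, w are the coordinates of the charts a, b and a
   barred index denotes the conjugate coordinate *)
Definition jacobian a b z A B : R[i] :=
  pd A (fun z' => zcoord B (transition a b z')) z.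

(* Tensor fields are given by their components in every chart; only the values
   on crange a are meaningful. *)
Definition scalarField := chart X -> Cn R n -> R[i].
Definition vectorField := chart X -> Cn R n -> 'I_n -> R[i].
Definition form1 := chart X -> Cn R n -> idx n -> R[i].
(* eta a z A B is the value of the form on the A-th and B-th coordinate
   fields. *)
Definition form2 := chart X -> Cn R n -> idx n -> idx n -> R[i].

(* sections of T^{1,0}X *)
Definition holomorphic_vector_field (V : vectorField) : Prop :=
  (forall a i, holomorphic (crange a) (fun z => V a z i)) /\
  (forall a b z, overlap a b z -> forall k,
     V b (transition a b z) k =
     \sum_(i < n) jacobian a b z (inl i) (inl k) * V a z i).

Definition smooth_form1 (beta : form1) : Prop :=
  (forall a A, smooth (crange a) (fun z => beta a z A)) /\
  (forall a b z, overlap a b z -> forall A,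
     beta a z A = \sum_B jacobian a b z A B * beta b (transition a b z) B).

Definition eq_form2 (eta theta : form2) : Prop :=
  forall a z, crange a z -> forall A B, eta a z A B = theta a z A B.

Definition sub_form2 (eta theta : form2) : form2 :=
  fun a z A B => eta a z A B - theta a z A B.

Definition d_form1 (beta : form1) : form2 := fun a z A B =>
  pd A (fun w => beta a w B) z - pd B (fun w => beta a w A) z.

Definition closed_form2 (eta : form2) : Prop :=
  forall a z, crange a z -> forall A B C,
    pd A (fun w => eta a w B C) z + pd B (fun w => eta a w C A) z
    + pd C (fun w => eta a w A B) z = 0.

(* de Rham cohomology with complex coefficients; for real forms, taking the
   real part of beta gives a real primitive. *)
Definition cohomologous (eta theta : form2) : Prop :=
  exists2 beta : form1,
    smooth_form1 beta & eq_form2 (sub_form2 eta theta) (d_form1 beta).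

(* component of V^{1,0} along the coordinate field A *)
Definition vcomp (V : vectorField) a z A : R[i] :=
  if A is inl i then V a z i else 0.

Definition lie_form2 (V : vectorField) (eta : form2) : form2 :=
  fun a z A B => \sum_C
    (vcomp V a z C * pd C (fun w => eta a w A B) z
     + pd A (fun w => vcomp V a w C) z * eta a z C B
     + pd B (fun w => vcomp V a w C) z * eta a z A C).

(* (i / 2 pi) M_ij dz^i /\ dzbar^j *)
Definition form11 (M : chart X -> Cn R n -> 'M[R[i]]_n) : form2 :=
  fun a z A B =>
    let c : R[i] := 'i / (2 * pi)%:C%C in
    match A, B with
    | inl i, inr j => c * M a z i j
    | inr i, inl j => - (c * M a z j i)
    | _, _ => 0
    end.

(* J-invariant Riemannian metrics, through g_{i jbar} = g(d/dz^i, d/dzbar^j) *)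
Record hermitianMetric := HermitianMetric {
  metric_mx :> chart X -> Cn R n -> 'M[R[i]]_n;
  metric_smooth : forall a i j, smooth (crange a) (fun z => metric_mx a z i j);
  metric_hermitian : forall a z, crange a z -> forall i j,
    metric_mx a z j i = (metric_mx a z i j)^*;
  metric_posdef : forall a z, crange a z -> forall v : 'rV[R[i]]_n, v != 0 ->
    0 < \sum_(i < n) \sum_(j < n) metric_mx a z i j * v 0 i * (v 0 j)^*;
  metric_compat : forall a b z, overlap a b z -> forall i j,
    metric_mx a z i j =
    \sum_(k < n) \sum_(l < n)
      jacobian a b z (inl i) (inl k) * (jacobian a b z (inl j) (inl l))^*
      * metric_mx b (transition a b z) k l
}.

Implicit Types g h : hermitianMetric.

(* omega(V, W) = g(JV, W) / 2 pi *)
Definition kahler_form g : form2 := form11 g.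

Definition kahler g : Prop := closed_form2 (kahler_form g).

Definition log_det g : scalarField :=
  fun a z => (ln (complex.Re (\det (g a z))))%:C%C.

Definition ricci_mx g : chart X -> Cn R n -> 'M[R[i]]_n :=
  fun a z => \matrix_(i, j) - pd (inl i) (pd (inr j) (log_det g a)) z.

(* -(i / 2 pi) d dbar log det g; for a metric that is not Kahler this is the
   Chern-Ricci form, i.e. the Chern form of the metric induced by g on
   the anticanonical bundle. *)
Definition ricci_form g : form2 := form11 (ricci_mx g).

(* s = 2 g^{i jbar} R_{i jbar}, the trace of the Riemannian Ricci tensor *)
Definition scalar_curvature g : scalarField :=
  fun a z => 2 * \tr (invmx (g a z) *m ricci_mx g a z).

(* g^{i jbar} d u / d zbar^j; g^{i jbar} is the inverse of the transpose of the
   matrix g_{i jbar}. *)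
Definition gradC g (u : scalarField) : vectorField :=
  fun a z i => \sum_(j < n) invmx (g a z) j i * pd (inr j) (u a) z.

(* Chern-Weil: the class c_1(X) is that of the Chern form of any Hermitian
   metric. *)
Definition represents_c1 (eta : form2) : Prop :=
  exists h, cohomologous eta (ricci_form h).

Definition fano : Prop :=
  [/\ compact [set: X], connected [set: X] &
      exists2 h, kahler h & represents_c1 (kahler_form h)].

Definition extremal g : Prop :=
  holomorphic_vector_field (gradC g (scalar_curvature g)).

Definition kahler_ricci_soliton g : Prop :=
  exists2 V : vectorField, holomorphic_vector_field V &
    eq_form2 (sub_form2 (ricci_form g) (kahler_form g))
             (lie_form2 V (kahler_form g)).

Definition kahler_einstein g : Prop :=
  eq_form2 (ricci_form g) (kahler_form g).

End ComplexGeometry.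

Arguments fano {R n} X.

(* Main.v *)
Require Import Defs.
From mathcomp Require Import all_boot all_order all_algebra.
From mathcomp Require Import complex spectral.
From mathcomp Require Import all_classical all_reals all_analysis.
From mathcomp Require Import ring lra.
Set Implicit Arguments.
Unset Strict Implicit.
Unset Printing Implicit Defensive.

Import Order.TTheory GRing.Theory Num.Theory.
Import numFieldNormedType.Exports.

Local Open Scope classical_set_scope.
Local Open Scope ring_scope.

(** The Ricci potential of a Kaehler-Ricci soliton can be written down
    explicitly, and for an extremal metric the maximum principle applies to a
    function built from this potential and the norm of the soliton field.

    Let V be the soliton field, alpha = g(V, .) the dual (0,1)-form,
    u = |V|^2 and P = Ric - g.  In coordinates the soliton equation, combined
    with the closedness of the Kaehler form, reads P_ij = d_i alpha_j
    (lemma [pd_alpha]).  Since V is holomorphic, applying d/dzbar^q to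
    tr_g P = d_k V^k + V^k d_k log det g gives - alpha_q - V^l P_lq, and
    applying it to u gives V^l P_lq.  Hence F := - (tr_g P + u) is a real
    function with dbar F = alpha, that is gradC F = V ([pdbar_potential]).
    It is globally defined because P_ij = d_i alpha_j is tensorial under
    holomorphic changes of coordinates ([potential_transition]).

    The scalar curvature is s = 2 (n - F - u), so for an extremal metric the
    field W := gradC u = - V - (gradC s) / 2 is holomorphic
    ([grad_sqnorm_holomorphic]).  Then Vbar u = Wbar F, and as V commutes with
    the antiholomorphic field Wbar, V Vbar u = Wbar V F = Wbar u
    ([V_sqnorm], [pd_V_sqnorm]).  At a maximum of u + e F^2, with e > 0, the
    gradient vanishes, so W = - 2 e F V there, and V Vbar u cancels the term
    2 e F (V Vbar F) of V Vbar (u + e F^2).  What remains is 2 e u^2, although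
    the Levi form is nonpositive at a maximum ([max_levi]): so u = 0 at that
    point ([local_max_sqnorm]).  Therefore u <= e max F^2 everywhere, for every
    e > 0, and u = 0.  So V = 0 ([V_eq0]), and the soliton equation becomes
    Ric = g.

    Smoothness is stated through iterated directional derivatives, so the
    calculus behind this argument (linearity in the direction, symmetry of
    second derivatives, chain rule) is first deduced from the mean value
    theorem on segments. *)

(** * Directional derivatives on a normed space *)

Section LineCalculus.
Variables (R : realType) (E : normedModType R).
Implicit Types (f : E -> R) (U : set E) (x v w : E).

Lemma is_derive_line f x v s : derivable f (x + s *: v) v ->
  is_derive s (1 : R) (fun t : R => f (x + t *: v)) ('D_v f (x + s *: v)).
Proof.
move=> df.
have e : (fun h : R => h^-1 *: (((fun t : R => f (x + t *: v)) \o shift s)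
            (h *: (1 : R)) - f (x + s *: v)))
       = (fun h => h^-1 *: ((f \o shift (x + s *: v)) (h *: v)
            - f (x + s *: v))).
  apply/funext => h /=; congr (_ *: (f _ - _)).
  by rewrite [h *: 1]mulr1 scalerDl addrCA.
by apply: DeriveDef; rewrite /derivable /derive e.
Qed.

Lemma line_mvt f x v :
  (forall s : R, 0 <= s <= 1 -> derivable f (x + s *: v) v) ->
  exists2 s : R, 0 < s < 1 & f (x + v) - f x = 'D_v f (x + s *: v).
Proof.
move=> df; pose g (t : R) := f (x + t *: v).
have dg (t : R) : 0 <= t <= 1 -> is_derive t (1 : R) g ('D_v f (x + t *: v)).
  by move=> /df; exact: is_derive_line.
have [||c] := @MVT R g (fun t => 'D_v f (x + t *: v)) 0 1 ltr01.
- by move=> t; rewrite in_itv/= => /andP[/ltW t0 /ltW t1]; apply: dg; rewrite t0.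
- apply: derivable_within_continuous => t; rewrite in_itv/= => t01.
  exact: (@ex_derive _ _ _ _ _ _ _ (dg t t01)).
- by rewrite in_itv/= subr0 mulr1 /g scale1r scale0r addr0 => c01 e; exists c.
Qed.

Lemma is_deriveZr f x v (a d : R) :
  is_derive x v f d -> is_derive x (a *: v) f (a * d).
Proof.
move=> fd; pose g (t : R) := f (x + t *: v).
have dg : is_derive (0 * a : R) (1 : R) g d.
  have := @is_derive_line f x v 0; rewrite scale0r addr0 mul0r => h.
  by rewrite -(@derive_val _ _ _ _ _ _ _ fd); apply: h.
have dc : is_derive (0 : R) (1 : R) (g \o ( *%R^~ a)) (d * a).
  apply: is_derive1_comp.
  have := @is_deriveM R R id (cst a) 0 1 1 0 _ _.
  rewrite scaler0 add0r => h; apply: is_derive_eq => //.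
  by rewrite [_ *: _]mulr1.
have e : (fun h : R => h^-1 *: (((g \o ( *%R^~ a)) \o shift 0)
            (h *: (1 : R)) - (g \o ( *%R^~ a)) 0))
       = (fun h => h^-1 *: ((f \o shift x) (h *: (a *: v)) - f x)).
  apply/funext => h /=; rewrite /g mul0r scale0r !addr0.
  by rewrite [h *: 1]mulr1 scalerA [x + _]addrC.
by case: dc; rewrite /derivable /derive e => ? ?; rewrite mulrC; apply: DeriveDef.
Qed.

Lemma segment_mvt f x v (t : R) :
  (forall s : R, `|s| <= `|t| -> derivable f (x + s *: v) v) ->
  exists2 s : R, `|s| <= `|t| & f (x + t *: v) - f x = t * 'D_v f (x + s *: v).
Proof.
move=> df.
have st (s : R) : 0 <= s <= 1 -> `|s * t| <= `|t|.
  by move=> /andP[s0 s1]; rewrite normrM ger0_norm// ler_piMl.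
have dft (s : R) : 0 <= s <= 1 ->
    is_derive (x + s *: (t *: v)) (t *: v) f (t * 'D_v f (x + (s * t) *: v)).
  move=> s01; apply: is_deriveZr; rewrite scalerA.
  by apply: derivableP; apply/df/st.
have [s /andP[s0 s1] ->] := @line_mvt f x (t *: v)
  (fun s s01 => @ex_derive _ _ _ _ _ _ _ (dft s s01)).
exists (s * t); first by apply: st; rewrite !ltW.
by rewrite (@derive_val _ _ _ _ _ _ _ (dft s _))// !ltW.
Qed.

(** This lemma and the next put neighbourhoods in the form of distances to x,
    which is how the mean value estimates below consume them. *)
Lemma open_dist U x : open U -> U x ->
  exists2 e : R, 0 < e & forall y, `|y| < e -> U (x + y).
Proof.
move=> oU Ux; have /nbhs_ballP[e e0 xU] : nbhs x U by apply: open_nbhs_nbhs.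
exists e => // y ye; apply: xU; rewrite -ball_normE /ball_/=.
by rewrite opprD addNKr normrN.
Qed.

Lemma continuous_dist (F : normedModType R) (f : E -> F) x :
  {for x, continuous f} -> forall e : R, 0 < e ->
  exists2 d : R, 0 < d & forall y, `|y| < d -> `|f (x + y) - f x| < e.
Proof.
move=> /cvgrPdist_lt fx e e0; have /nbhs_ballP[d d0 xd] := fx _ e0.
exists d => // y yd; rewrite distrC; apply: xd; rewrite -ball_normE /ball_/=.
by rewrite opprD addNKr normrN.
Qed.

Lemma is_derive_cvg f x v (d : R) :
  is_derive x v f d <->
  (fun h : R => h^-1 *: ((f \o shift x) (h *: v) - f x)) @ 0^' --> d.
Proof.
split=> [fd|fd].
  by rewrite -(@derive_val _ _ _ _ _ _ _ fd); exact: (@ex_derive _ _ _ _ _ _ _ fd).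
by apply: DeriveDef; [apply/cvg_ex; exists d|apply/cvg_lim].
Qed.

Lemma is_deriveP f x v (d : R) :
  is_derive x v f d <->
  (forall e : R, 0 < e -> exists2 r : R, 0 < r &
     forall t : R, t != 0 -> `|t| < r ->
       `|t^-1 * (f (x + t *: v) - f x) - d| < e).
Proof.
split=> [/is_derive_cvg/cvgrPdist_lt fd e e0|H].
  have /nbhs_ballP[r r0 xr] := fd _ e0.
  exists r => // t t0 tr; rewrite distrC [x + _]addrC; apply: xr => //.
  by rewrite /ball/= sub0r normrN.
apply/is_derive_cvg/cvgrPdist_lt => e /H[r r0 xr].
apply/nbhs_ballP; exists r => // t.
rewrite /ball/= sub0r normrN => tr t0; rewrite distrC [_ *: v + _]addrC.
exact: xr.
Qed.

(** Existence of directional derivatives alone does not make them additive in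
    the direction.  Continuity of the derivative along w does: the second leg
    of the path x, x + tv, x + tv + tw contributes t times a value of that
    derivative at a point tending to x. *)
Lemma is_deriveDr U f x v w : open U -> U x ->
  (forall z, U z -> derivable f z w) -> derivable f x v ->
  {for x, continuous ('D_w f)} ->
  is_derive x (v + w) f ('D_v f x + 'D_w f x).
Proof.
move=> oU Ux dw dv cw; apply/is_deriveP => e e0.
have e20 : 0 < e / 2 by rewrite divr_gt0.
have /is_deriveP/(_ _ e20)[r1 r10 H1] := derivableP dv.
have [r2 r20 H2] := continuous_dist cw e20.
have [r3 r30 H3] := open_dist oU Ux.
pose m := `|v| + `|w| + 1.
have m0 : 0 < m by rewrite ltr_wpDl// addr_ge0.
exists (Num.min r1 (Num.min r2 r3 / m)).
  by rewrite lt_min r10 divr_gt0// lt_min r20.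
move=> t t0; rewrite lt_min => /andP[tr1 trm].
have small (s : R) : `|s| <= `|t| -> `|t *: v + s *: w| < Num.min r2 r3.
  move=> st; rewrite (le_lt_trans (ler_normD _ _))// !normrZ.
  move: trm; rewrite ltr_pdivlMr//; apply: le_lt_trans.
  rewrite /m -addrA mulrDr lerD2l mulrDr mulr1.
  by rewrite ler_wpDr// ler_wpM2r.
have [s st] : exists2 s : R, `|s| <= `|t| &
    f (x + t *: v + t *: w) - f (x + t *: v) = t * 'D_w f (x + t *: v + s *: w).
  apply: segment_mvt => s /small; rewrite lt_min => /andP[_ s3].
  by apply: dw; rewrite -addrA; apply: H3.
move=> mv; rewrite scalerDr addrA.
have -> : t^-1 * (f (x + t *: v + t *: w) - f x) - ('D_v f x + 'D_w f x)
   = (t^-1 * (f (x + t *: v) - f x) - 'D_v f x)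
     + ('D_w f (x + (t *: v + s *: w)) - 'D_w f x).
  rewrite -[f (x + _ + _)](subrK (f (x + t *: v))) mv [x + (_ + _)]addrA.
  by field.
rewrite (le_lt_trans (ler_normD _ _))// (splitr e) ltrD// ?H1//.
by apply: H2; have := small _ st; rewrite lt_min => /andP[].
Qed.

Lemma schwarz U f x v w : open U -> U x ->
  (forall z, U z -> derivable f z v) -> (forall z, U z -> derivable f z w) ->
  (forall z, U z -> derivable ('D_v f) z w) ->
  (forall z, U z -> derivable ('D_w f) z v) ->
  {for x, continuous ('D_w ('D_v f))} -> {for x, continuous ('D_v ('D_w f))} ->
  'D_w ('D_v f) x = 'D_v ('D_w f) x.
Proof.
move=> oU Ux dv dw dvw dwv cvw cwv.
(* the mixed second difference is a value of either mixed derivative *)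
have key (v' w' : E) : (forall z, U z -> derivable f z v') ->
    (forall z, U z -> derivable ('D_v' f) z w') ->
    {for x, continuous ('D_w' ('D_v' f))} -> forall e : R, 0 < e ->
    exists2 r : R, 0 < r & forall t : R, t != 0 -> `|t| < r ->
    `|(t * t)^-1 * (f (x + t *: v' + t *: w') - f (x + t *: v')
        - (f (x + t *: w') - f x)) - 'D_w' ('D_v' f) x| < e.
  move=> {}dv {}dvw {}cvw e e0.
  have [r2 r20 H2] := continuous_dist cvw e0.
  have [r3 r30 H3] := open_dist oU Ux.
  pose m := `|v'| + `|w'| + 1.
  have m0 : 0 < m by rewrite ltr_wpDl// addr_ge0.
  exists (Num.min r2 r3 / m); first by rewrite divr_gt0// lt_min r20.
  move=> t t0; rewrite ltr_pdivlMr// => trm.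
  have small (a b : R) : `|a| <= `|t| -> `|b| <= `|t| ->
      `|a *: v' + b *: w'| < Num.min r2 r3.
    move=> at_ bt; rewrite (le_lt_trans (ler_normD _ _))// !normrZ.
    apply: le_lt_trans trm.
    rewrite /m -addrA mulrDr mulrDr mulr1 lerD//; first by rewrite ler_wpM2r.
    by rewrite ler_wpDr// ler_wpM2r.
  have smallU (a b : R) : `|a| <= `|t| -> `|b| <= `|t| ->
      U (x + a *: v' + b *: w').
    move=> at_ bt; have := small _ _ at_ bt; rewrite lt_min => /andP[_ ?].
    by rewrite -addrA; apply: H3.
  pose g z := f (z + t *: w') - f z.
  have dg (s : R) : `|s| <= `|t| ->
     is_derive (x + s *: v') v' g
       ('D_v' f (x + s *: v' + t *: w') - 'D_v' f (x + s *: v')).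
    move=> st; apply: is_deriveB; last first.
      apply/derivableP/dv.
      by have := smallU s 0; rewrite scale0r addr0 normr0 normr_ge0; apply.
    have /derivableP/is_deriveP K := dv _ (smallU s t st (lexx _)).
    apply/is_deriveP => e' /K[r r0 rr]; exists r => // a a0 ar.
    by rewrite [x + _ + _ + _]addrAC; apply: rr.
  have [|s st gs] := @segment_mvt g x v' t.
    by move=> s st; apply: (@ex_derive _ _ _ _ _ _ _ (dg s st)).
  rewrite (@derive_val _ _ _ _ _ _ _ (dg s st)) in gs.
  have [|a at_ gsa] := @segment_mvt ('D_v' f) (x + s *: v') w' t.
    by move=> a at_; apply/dvw/smallU.
  rewrite {}gsa in gs.
  have -> : f (x + t *: v' + t *: w') - f (x + t *: v') -
       (f (x + t *: w') - f x) = g (x + t *: v') - g x by [].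
  rewrite gs mulrA mulKf ?mulf_neq0//.
  by have := small _ _ st at_; rewrite lt_min -addrA => /andP[/H2].
apply/eqP; rewrite -subr_eq0 -normr_le0; apply/ler_addgt0Pl => e e0.
rewrite addr0.
have e20 : 0 < e / 2 by rewrite divr_gt0.
have [r1 r10 H1] := key _ _ dv dvw cvw _ e20.
have [r2 r20 H2] := key _ _ dw dwv cwv _ e20.
pose t := Num.min r1 r2 / 2.
have t0 : 0 < t by rewrite divr_gt0// lt_min r10.
have : `|t| < Num.min r1 r2.
  by rewrite gtr0_norm// /t ltr_pdivrMr// ltr_pMr ?lt_min ?r10// ltr1n.
rewrite lt_min => /andP[/(H1 _ (lt0r_neq0 t0)) B1 /(H2 _ (lt0r_neq0 t0)) B2].
rewrite [e]splitr ltW//; apply: le_lt_trans (ltrD B1 B2).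
rewrite [X in _ <= X + _]distrC; apply: le_trans (ler_normD _ _).
rewrite le_eqVlt; apply/orP; left; apply/eqP; congr `|_|.
rewrite [x + t *: w + t *: v]addrAC.
move: (f (x + _ + _)) (f (x + t *: v)) (f (x + t *: w)) (f x) => a b c d.
by move: ('D_w ('D_v f) x) ('D_v ('D_w f) x) (t * t)^-1 => p q k; ring.
Qed.

Lemma local_max_derive f x v : derivable f x v ->
  (exists2 r : R, 0 < r & forall t : R, `|t| < r -> f (x + t *: v) <= f x) ->
  'D_v f x = 0.
Proof.
move=> df [r r0 xr]; have /is_deriveP H := derivableP df.
apply/eqP; rewrite -normr_le0; apply/ler_addgt0Pl => e e0; rewrite addr0.
have [r' r'0 H'] := H _ e0.
pose t := Num.min r r' / 2.
have t0 : 0 < t by rewrite divr_gt0// lt_min r0.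
have tl : `|t| < Num.min r r'.
  by rewrite gtr0_norm// /t ltr_pdivrMr// ltr_pMr ?lt_min ?r0// ltr1n.
have := tl; rewrite lt_min => /andP[tr tr'].
have := H' _ (lt0r_neq0 t0) tr'; have ntr' : `|- t| < r' by rewrite normrN.
have := H' (- t) _ ntr'; rewrite oppr_eq0 lt0r_neq0// => /(_ isT).
have ntr : `|- t| < r by rewrite normrN.
have A1 : t^-1 * (f (x + t *: v) - f x) <= 0.
  by rewrite pmulr_rle0 ?invr_gt0// subr_le0 xr.
have A2 : 0 <= (- t)^-1 * (f (x + (- t) *: v) - f x).
  by rewrite nmulr_rge0 ?invr_lt0 ?oppr_lt0// subr_le0 xr.
move: A1 A2; set a := _ * _; set b := _ * _ => a0 b0.
by rewrite !ltr_norml ler_norml; lra.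
Qed.

(** If the second derivative were positive, the first one, which vanishes
    at x, would be positive slightly further along v, and the mean value
    theorem would make f exceed its maximum. *)
Lemma local_max_derive2 U f x v : open U -> U x ->
  (forall z, U z -> derivable f z v) -> derivable ('D_v f) x v ->
  (exists2 r : R, 0 < r & forall t : R, `|t| < r -> f (x + t *: v) <= f x) ->
  'D_v ('D_v f) x <= 0.
Proof.
move=> oU Ux df ddf mx; have d0 := local_max_derive (df _ Ux) mx.
case: mx => r r0 xr; rewrite leNgt; apply/negP => dd0.
have /is_deriveP/(_ _ dd0)[r1 r10 H1] := derivableP ddf.
have [r3 r30 H3] := open_dist oU Ux.
pose m := `|v| + 1.
have m0 : 0 < m by rewrite ltr_wpDl.
pose q := Num.min r (Num.min r1 (r3 / m)).
have q0 : 0 < q by rewrite !lt_min r0 r10 divr_gt0.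
pose t := q / 2.
have t0 : 0 < t by rewrite divr_gt0.
have tq : t < q by rewrite /t ltr_pdivrMr// ltr_pMr// ltr1n.
have := tq; rewrite !lt_min => /and3P[tr tr1 trm].
have [s /andP[s0 s1] e] : exists2 s : R, 0 < s < 1 &
    f (x + t *: v) - f x = 'D_(t *: v) f (x + s *: (t *: v)).
  apply: line_mvt => s /andP[s0 s1]; rewrite scalerA.
  apply: (@ex_derive _ _ _ _ _ _ _ (is_deriveZr t (derivableP (df _ _)))).
  apply: H3; rewrite normrZ normrM !ger0_norm// ?(ltW t0)//.
  move: trm; rewrite ltr_pdivlMr//; apply: le_lt_trans.
  rewrite ler_pM ?mulr_ge0 ?(ltW t0) ?(ltW q0)//; last by rewrite /m lerDl.
  by rewrite ler_piMl// ltW.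
have st0 : 0 < s * t by rewrite mulr_gt0.
have stt : s * t < t by rewrite gtr_pMl.
have Us : U (x + s *: (t *: v)).
  rewrite scalerA; apply: H3; rewrite normrZ gtr0_norm//.
  move: trm; rewrite ltr_pdivlMr//; apply: le_lt_trans.
  by rewrite ler_pM ?(ltW st0) ?(ltW stt)// /m lerDl.
have := xr t; rewrite gtr0_norm// => /(_ tr); rewrite -subr_le0 e.
rewrite (@derive_val _ _ _ _ _ _ _ (is_deriveZr t (derivableP (df _ Us)))).
rewrite pmulr_rle0// scalerA => le0.
have := H1 (s * t); rewrite d0 subr0 gtr0_norm// gt_eqF// => /(_ isT (lt_trans stt tr1)).
rewrite ltr_norml => /andP[+ _].
rewrite ltrBDr addNr pmulr_rgt0 ?invr_gt0//.
by rewrite ltNge le0.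
Qed.

End LineCalculus.

(** * Functions of class C^k on open sets of C^n *)

Section CkCalculus.
Variables (R : realType) (n : nat).
Local Notation E := (Cn R n).
Implicit Types (f g : E -> R) (U V : set E) (x v w z : E).

Lemma Ck_continuous k U f z : Ck k U f -> U z -> {for z, continuous f}.
Proof. by case: k => [|k] [cf _]; apply: cf. Qed.

Lemma Ck_derivable k U f z v : Ck k.+1 U f -> U z -> derivable f z v.
Proof. by move=> [_ /(_ v)[df _]]; apply: df. Qed.

Lemma Ck_derive k U f v : Ck k.+1 U f -> Ck k U ('D_v f).
Proof. by move=> [_ /(_ v)[_]]. Qed.

Lemma CkW k U f : Ck k.+1 U f -> Ck k U f.
Proof.
elim: k f => [|k IH] f [cf df]; split=> // v.
by have [dfv /IH] := df v.
Qed.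

Lemma Ck_leq k l U f : (k <= l)%N -> Ck l U f -> Ck k U f.
Proof.
elim: l => [|l IH]; first by rewrite leqn0 => /eqP ->.
by rewrite leq_eqVlt => /orP[/eqP ->//|/IH{}IH /CkW/IH].
Qed.

Lemma open_near_eq U f g z : open U -> (forall w, U w -> f w = g w) -> U z ->
  \forall w \near z, f w = g w.
Proof.
by move=> oU fg Uz; near=> w; apply: fg; near: w; apply: open_nbhs_nbhs.
Unshelve. all: by end_near. Qed.

Lemma derive_eq_in U f g z v : open U -> (forall w, U w -> f w = g w) -> U z ->
  'D_v f z = 'D_v g z.
Proof. by move=> oU fg Uz; apply/near_eq_derive/(open_near_eq oU fg). Qed.

Lemma eq_continuous_in U f g z : open U -> (forall w, U w -> f w = g w) -> U z ->
  {for z, continuous f} -> {for z, continuous g}.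
Proof.
move=> oU fg Uz; rewrite /prop_for /continuous_at -(fg z Uz).
by apply: cvg_trans; apply: near_eq_cvg; apply: (open_near_eq oU fg).
Qed.

(** The closure properties below compute derivatives that agree with the
    expected formulas only on U; this transfers regularity along such
    equalities. *)
Lemma eq_Ck k U f g : open U -> (forall z, U z -> f z = g z) ->
  Ck k U f -> Ck k U g.
Proof.
move=> oU; elim: k f g => [|k IH] f g fg [cf df]; split=> //.
- by move=> z Uz; apply: (eq_continuous_in oU fg Uz); apply: cf.
- by move=> z Uz; apply: (eq_continuous_in oU fg Uz); apply: cf.
- move=> v; have [dfv /IH cdf] := df v; split.
    by move=> z Uz; apply: near_eq_derivable (dfv _ Uz); apply: (open_near_eq oU fg).
  by apply: cdf => z Uz; apply: (derive_eq_in v oU fg).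
Qed.

Lemma Ck_cst k U (c : R) : Ck k U (fun=> c).
Proof.
elim: k c => [|k IH] c; split=> //; do ?[by move=> z _; apply: cvg_cst].
move=> v; split; first by move=> z _; exact: derivable_cst.
have -> : 'D_v (fun=> c : R) = fun _ : E => 0 by apply/funext => z; exact: derive_cst.
exact: IH.
Qed.

Lemma CkD k U f g : open U -> Ck k U f -> Ck k U g -> Ck k U (fun z => f z + g z).
Proof.
move=> oU; elim: k f g => [|k IH] f g [cf df] [cg dg]; split=> //;
  do ?[by move=> z Uz; apply: cvgD; [exact: cf|exact: cg]].
move=> v; have [dfv cdf] := df v; have [dgv cdg] := dg v; split.
  by move=> z Uz; apply: derivableD; [exact: dfv|exact: dgv].
apply: (eq_Ck oU) (IH _ _ cdf cdg) => z Uz; apply/esym/deriveD; [exact: dfv|exact: dgv].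
Qed.

Lemma CkN k U f : open U -> Ck k U f -> Ck k U (fun z => - f z).
Proof.
move=> oU; elim: k f => [|k IH] f [cf df].
  by split=> [z Uz|]; [apply: cvgN; exact: cf|exact: I].
split=> [z Uz|]; first by apply: cvgN; exact: cf.
move=> v; have [dfv cdf] := df v; split.
  by move=> z Uz; apply: derivableN; exact: dfv.
by apply: (eq_Ck oU) (IH _ cdf) => z Uz; apply/esym/deriveN; exact: dfv.
Qed.

Lemma CkM k U f g : open U -> Ck k U f -> Ck k U g -> Ck k U (fun z => f z * g z).
Proof.
move=> oU; elim: k f g => [|k IH] f g Cf Cg;
  have [cf df] := Cf; have [cg dg] := Cg; split=> //;
  do ?[by move=> z Uz; apply: cvgM; [exact: cf|exact: cg]].
move=> v; have [dfv cdf] := df v; have [dgv cdg] := dg v; split.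
  by move=> z Uz; apply: derivableM; [exact: dfv|exact: dgv].
apply: (eq_Ck oU) (CkD oU (IH _ _ (CkW Cf) cdg) (IH _ _ (CkW Cg) cdf)) => z Uz.
by apply/esym/deriveM; [exact: dfv|exact: dgv].
Qed.

(** The derivative of 1/f is - (1/f)^2 f', so regularity of 1/f is bootstrapped
    from one order below. *)
Lemma CkV k U f : open U -> (forall z, U z -> f z != 0) -> Ck k U f ->
  Ck k U (fun z => (f z)^-1).
Proof.
move=> oU f0; elim: k => [|k IH] Cf; have [cf df] := Cf; split=> //;
  do ?[by move=> z Uz; apply: cvgV; [exact: f0|exact: cf]].
move=> v; have [dfv cdf] := df v; split.
  by move=> z Uz; apply: derivableV; [exact: f0|exact: dfv].
have IHf := IH (CkW Cf).
apply: (eq_Ck oU) (CkM oU (CkN oU (CkM oU IHf IHf)) cdf) => z Uz.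
rewrite deriveV ?f0//; last exact: dfv.
by rewrite -invfM -expr2.
Qed.

Lemma is_derive_ln f z v : 0 < f z -> derivable f z v ->
  is_derive z v (fun w => ln (f w)) ((f z)^-1 * 'D_v f z).
Proof.
move=> f0 df; have /= := @is_derive_line R E f z v 0.
rewrite scale0r addr0 => /(_ df) dl.
have dc : is_derive (0 : R) (1 : R) (@ln R \o (fun t : R => f (z + t *: v)))
    ((f z)^-1 * 'D_v f z).
  apply: is_derive1_comp; rewrite scale0r addr0; exact: is_derive1_ln.
apply/is_deriveP => e e0; have [r r0 rr] := (@is_deriveP R _ _ _ _ _).1 dc _ e0.
exists r => // t t0 tr; have := rr t t0 tr.
by rewrite /= scale0r !add0r addr0 [t *: 1]mulr1.
Qed.

Lemma Ck_ln k U f : open U -> (forall z, U z -> 0 < f z) -> Ck k U f ->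
  Ck k U (fun z => ln (f z)).
Proof.
move=> oU f0; case: k => [|k] Cf; have [cf df] := Cf; split=> //;
  do ?[by move=> z Uz; apply: continuous_comp; [exact: cf|exact/continuous_ln/f0]].
move=> v; have [dfv cdf] := df v; split.
  by move=> z Uz; apply: (@ex_derive _ _ _ _ _ _ _ (is_derive_ln (f0 _ Uz) (dfv _ Uz))).
have CV : Ck k U (fun z => (f z)^-1).
  by apply: CkV => //; [move=> z /f0; rewrite lt0r => /andP[]|exact: CkW].
apply: (eq_Ck oU) (CkM oU CV cdf) => z Uz.
by rewrite (@derive_val _ _ _ _ _ _ _ (is_derive_ln (f0 _ Uz) (dfv _ Uz))).
Qed.

Lemma Ck_schwarz U f z v w : open U -> Ck 2 U f -> U z ->
  'D_w ('D_v f) z = 'D_v ('D_w f) z.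
Proof.
move=> oU Cf Uz; have dv u y (Uy : U y) : derivable f y u by apply: Ck_derivable Cf Uy.
have Cd u := Ck_derive u Cf.
have ddv u u' y (Uy : U y) : derivable ('D_u f) y u' by apply: Ck_derivable (Cd u) Uy.
exact: (schwarz oU Uz (dv v) (dv w) (ddv v w) (ddv w v)
  (Ck_continuous (Ck_derive w (Cd v)) Uz) (Ck_continuous (Ck_derive v (Cd w)) Uz)).
Qed.

Lemma CnE (y : E) : y = \sum_i y.1 0 i *: ex R i + \sum_i y.2 0 i *: ey R i.
Proof.
have s1 (u : 'I_n -> E) : (\sum_i u i).1 = \sum_i (u i).1.
  exact: (big_morph (fun p : E => p.1) (fun _ _ => erefl) erefl).
have s2 (u : 'I_n -> E) : (\sum_i u i).2 = \sum_i (u i).2.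
  exact: (big_morph (fun p : E => p.2) (fun _ _ => erefl) erefl).
rewrite [LHS]surjective_pairing; apply/pair_equal_spec; split.
  rewrite [RHS]/= s1 s1 /= [X in _ + X]big1 ?addr0 => [|i _]; last by rewrite scaler0.
  exact: row_sum_delta.
rewrite [RHS]/= s2 s2 /= [X in X + _]big1 ?add0r => [|i _]; last by rewrite scaler0.
exact: row_sum_delta.
Qed.

Lemma is_derive_lin U f x y : open U -> Ck 1 U f -> U x ->
  is_derive x y f (\sum_i y.1 0 i * 'D_(ex R i) f x + \sum_i y.2 0 i * 'D_(ey R i) f x).
Proof.
move=> oU Cf Ux.
have dv u z (Uz : U z) : derivable f z u by apply: Ck_derivable Cf Uz.
have DD u w a b : is_derive x u f a -> is_derive x w f b -> is_derive x (u + w) f (a + b).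
  move=> fa fb; rewrite -(@derive_val _ _ _ _ _ _ _ fa) -(@derive_val _ _ _ _ _ _ _ fb).
  exact: (is_deriveDr oU Ux (dv w) (dv u _ Ux) (Ck_continuous (Ck_derive w Cf) Ux)).
have DS (c : 'I_n -> R) (u : 'I_n -> E) :
    is_derive x (\sum_i c i *: u i) f (\sum_i c i * 'D_(u i) f x).
  elim/big_rec2: _ => [|i w a _ IH]; first exact: is_derive0.
  by apply: DD => //; apply: is_deriveZr; apply/derivableP/dv.
by rewrite {1}[y]CnE; apply: DD; apply: DS.
Qed.

End CkCalculus.

(** * The chain rule *)

Section Chain.
Variables (R : realType) (n : nat).
Local Notation E := (Cn R n).
Implicit Types (f g : E -> R) (U V : set E) (x v w z : E).

(** On the segment from T z to T (z + tv) the mean value theorem and the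
    linearity of the derivative in its direction express the increment of f as
    the sum of the increments of the components of T, times partial derivatives
    of f at an intermediate point.  That point tends to T z with t, and the
    partial derivatives are continuous. *)
Lemma is_derive_chain V f (T : E -> E) z v (a b : 'I_n -> R) :
  open V -> Ck 1 V f -> V (T z) -> {for z, continuous T} ->
  (forall i, is_derive z v (fun w => (T w).1 0 i) (a i)) ->
  (forall i, is_derive z v (fun w => (T w).2 0 i) (b i)) ->
  is_derive z v (fun w => f (T w))
    (\sum_i a i * 'D_(ex R i) f (T z) + \sum_i b i * 'D_(ey R i) f (T z)).
Proof.
move=> oV Cf VTz cT da db.
have [e e0 He] := open_dist oV VTz.
have [r r0 Hr] := continuous_dist cT e0.
pose D (t : R) : E := T (z + t *: v) - T z.
(* the mean value point on the segment from T z to T (z + t v) *)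
have pt (t : R) : exists y : E, `|y - T z| <= `|D t| /\ (`|t *: v| < r ->
    f (T (z + t *: v)) - f (T z) =
    \sum_i (D t).1 0 i * 'D_(ex R i) f y + \sum_i (D t).2 0 i * 'D_(ey R i) f y).
  have [tr|tr] := ltP `|t *: v| r; last first.
    by exists (T z); rewrite subrr normr0; split.
  have Ds (s : R) : 0 <= s <= 1 -> `|s *: D t| <= `|D t|.
    by move=> /andP[s0 s1]; rewrite normrZ ger0_norm// ler_piMl.
  have Vs (s : R) : 0 <= s <= 1 -> V (T z + s *: D t).
    by move=> /Ds s01; apply: He; apply: le_lt_trans s01 _; exact: Hr.
  have [s /andP[s0 s1]] := @line_mvt R E f (T z) (D t)
    (fun s s01 => Ck_derivable Cf (Vs s s01)).
  have s01 : 0 <= s <= 1 by rewrite !ltW.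
  have -> : T z + D t = T (z + t *: v) by rewrite /D addrCA subrr addr0.
  move=> ->; exists (T z + s *: D t); split.
    by rewrite addrC addKr; exact: Ds.
  move=> _; exact: (@derive_val _ _ _ _ _ _ _ (is_derive_lin (D t) oV Cf (Vs s s01))).
have [y Hy] := choice pt.
have near_small (d : R) : 0 < d -> \forall t \near 0^', `|t *: v| < d.
  move=> d0; apply/nbhs_ballP; exists (d / (`|v| + 1)).
    by rewrite /= divr_gt0// ltr_wpDl.
  move=> t; rewrite /ball/= sub0r normrN ltr_pdivlMr ?ltr_wpDl// => td _.
  by rewrite normrZ (le_lt_trans _ td)// ler_wpM2l// lerDl.
have cy : y t @[t --> 0^'] --> T z.
  apply/cvgrPdist_lt => d d0; have [r' r'0 Hr'] := continuous_dist cT d0.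
  near=> t; rewrite distrC; apply: le_lt_trans (Hy t).1 _; apply: Hr'.
  by near: t; apply: near_small.
apply/is_derive_cvg.
have quot : \forall t \near 0^',
    \sum_i (t^-1 * (D t).1 0 i) * 'D_(ex R i) f (y t)
      + \sum_i (t^-1 * (D t).2 0 i) * 'D_(ey R i) f (y t)
    = t^-1 *: (((fun w => f (T w)) \o shift z) (t *: v) - f (T z)).
  near=> t; rewrite /= [t *: v + z]addrC (Hy t).2; last by near: t; apply: near_small.
  rewrite [RHS]mulrDr; congr (_ + _); rewrite mulr_sumr;
  by apply: eq_bigr => i _; rewrite mulrA.
apply: cvg_trans (near_eq_cvg quot) _.
have cd u : 'D_u f (y t) @[t --> 0^'] --> 'D_u f (T z).
  exact: (cvg_comp _ _ cy (Ck_continuous (Ck_derive u Cf) VTz)).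
apply: cvgD; apply: cvg_big => [|i _]; do ?[exact: add_continuous].
  apply: cvgM; last exact: cd.
  have /is_derive_cvg := da i; apply: cvg_trans; apply: near_eq_cvg; near=> t.
  by rewrite /= [t *: v + z]addrC /D !mxE.
apply: cvgM; last exact: cd.
have /is_derive_cvg := db i; apply: cvg_trans; apply: near_eq_cvg; near=> t.
by rewrite /= [t *: v + z]addrC /D !mxE.
Unshelve. all: by end_near. Qed.

End Chain.

(** * Wirtinger calculus *)

Section ComplexNumbers.
Variable R : realType.
Implicit Types x y : R[i].

Lemma cReD x y : complex.Re (x + y) = complex.Re x + complex.Re y.
Proof. by case: x; case: y. Qed.
Lemma cImD x y : complex.Im (x + y) = complex.Im x + complex.Im y.
Proof. by case: x; case: y. Qed.
Lemma cReN x : complex.Re (- x) = - complex.Re x. Proof. by case: x. Qed.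
Lemma cImN x : complex.Im (- x) = - complex.Im x. Proof. by case: x. Qed.
Lemma cReM x y : complex.Re (x * y) =
  complex.Re x * complex.Re y - complex.Im x * complex.Im y.
Proof. by case: x; case: y. Qed.
Lemma cImM x y : complex.Im (x * y) =
  complex.Re x * complex.Im y + complex.Im x * complex.Re y.
Proof. by case: x => a b; case: y => c d. Qed.
Lemma cRe_conj x : complex.Re x^* = complex.Re x. Proof. by case: x. Qed.
Lemma cIm_conj x : complex.Im x^* = - complex.Im x. Proof. by case: x. Qed.
Lemma cReZ (k : R) x : complex.Re (k%:C%C * x) = k * complex.Re x.
Proof. by rewrite cReM/= mul0r subr0. Qed.
Lemma cImZ (k : R) x : complex.Im (k%:C%C * x) = k * complex.Im x.
Proof. by rewrite cImM/= mul0r addr0. Qed.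
Lemma complex_ext x y : complex.Re x = complex.Re y ->
  complex.Im x = complex.Im y -> x = y.
Proof. by case: x => a b; case: y => c d /= -> ->. Qed.

(** A combination with real coefficients, computed componentwise: this turns
    the expansion of a real directional derivative of f into one of its
    complex values. *)
Lemma complex_lin (I : Type) (r : seq I) (p q : I -> R) (X Y : I -> R[i]) :
  Complex
    (\sum_(i <- r) p i * complex.Re (X i) + \sum_(i <- r) q i * complex.Re (Y i))
    (\sum_(i <- r) p i * complex.Im (X i) + \sum_(i <- r) q i * complex.Im (Y i))
  = \sum_(i <- r) ((p i)%:C%C * X i + (q i)%:C%C * Y i).
Proof.
rewrite -!big_split; elim: r => [|i r IH]; first by rewrite !big_nil.
rewrite !big_cons -IH; apply: complex_ext.
  by rewrite cReD cReD !cReZ.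
by rewrite cImD cImD !cImZ.
Qed.

Lemma conj_i : ('i : R[i])^* = - 'i.
Proof. exact: conjCi. Qed.
Lemma conj2 : (2 : R[i])^* = 2.
Proof. by rewrite rmorph_nat. Qed.

End ComplexNumbers.

Arguments pd : simpl never.

Section ComplexCalculus.
Variables (R : realType) (n : nat).
Local Notation E := (Cn R n).
Local Notation C := R[i].
Implicit Types (f g : E -> C) (U V : set E) (v w z : E) (A B : idx n).

(** [cderive] is a total function; this predicate adds the existence of the
    derivative, so that values can be combined by the usual rules. *)
Definition is_cderive v f z (d : C) : Prop :=
  is_derive z v (fun w => complex.Re (f w)) (complex.Re d) /\
  is_derive z v (fun w => complex.Im (f w)) (complex.Im d).

Lemma cderive_val v f z d : is_cderive v f z d -> cderive v f z = d.
Proof.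
move=> [fr fi]; rewrite /cderive.
rewrite (@derive_val _ _ _ _ _ _ _ fr) (@derive_val _ _ _ _ _ _ _ fi).
by case: d {fr fi}.
Qed.

Lemma is_cderiveD v f g z a b : is_cderive v f z a -> is_cderive v g z b ->
  is_cderive v (fun w => f w + g w) z (a + b).
Proof.
move=> [fr fi] [gr gi]; split.
  rewrite cReD; under eq_fun do rewrite cReD; exact: is_deriveD.
rewrite cImD; under eq_fun do rewrite cImD; exact: is_deriveD.
Qed.

Lemma is_cderiveN v f z a : is_cderive v f z a ->
  is_cderive v (fun w => - f w) z (- a).
Proof.
move=> [fr fi]; split.
  rewrite cReN; under eq_fun do rewrite cReN; exact: is_deriveN.
rewrite cImN; under eq_fun do rewrite cImN; exact: is_deriveN.
Qed.

Lemma is_cderiveM v f g z a b : is_cderive v f z a -> is_cderive v g z b ->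
  is_cderive v (fun w => f w * g w) z (a * g z + f z * b).
Proof.
move=> [fr fi] [gr gi]; split.
  under eq_fun do rewrite cReM.
  apply: is_derive_eq (is_deriveB (is_deriveM fr gr) (is_deriveM fi gi)) _.
  rewrite cReD !cReM /GRing.scale/=; ring.
under eq_fun do rewrite cImM.
apply: is_derive_eq (is_deriveD (is_deriveM fr gi) (is_deriveM fi gr)) _.
rewrite cImD !cImM /GRing.scale/=; ring.
Qed.

Lemma is_cderive_conj v f z a : is_cderive v f z a ->
  is_cderive v (fun w => (f w)^*) z a^*.
Proof.
move=> [fr fi]; split.
  by rewrite cRe_conj; under eq_fun do rewrite cRe_conj.
rewrite cIm_conj; under eq_fun do rewrite cIm_conj; exact: is_deriveN.
Qed.

Lemma is_cderive_cst v (c : C) z : is_cderive v (fun=> c) z 0.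
Proof. by split; exact: is_derive_cst. Qed.

Lemma smooth_cderivable U f v z : smooth U f -> U z ->
  is_cderive v f z (cderive v f z).
Proof.
move=> Sf Uz; have [Cr Ci] := Sf 1%N.
by split; apply/derivableP; [exact: (Ck_derivable Cr Uz)|exact: (Ck_derivable Ci Uz)].
Qed.

Lemma eq_smooth U f g : open U -> (forall z, U z -> f z = g z) ->
  smooth U f -> smooth U g.
Proof.
move=> oU fg Sf k; have [Cr Ci] := Sf k.
by split; [apply: eq_Ck Cr|apply: eq_Ck Ci] => // z /fg ->.
Qed.

Lemma smooth_cst U (c : C) : smooth U (fun=> c).
Proof. by move=> k; split; exact: Ck_cst. Qed.

Lemma smoothD U f g : open U -> smooth U f -> smooth U g ->
  smooth U (fun z => f z + g z).
Proof.
move=> oU Sf Sg k; have [fr fi] := Sf k; have [gr gi] := Sg k; split.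
  under eq_fun do rewrite cReD; exact: CkD.
under eq_fun do rewrite cImD; exact: CkD.
Qed.

Lemma smoothN U f : open U -> smooth U f -> smooth U (fun z => - f z).
Proof.
move=> oU Sf k; have [fr fi] := Sf k; split.
  under eq_fun do rewrite cReN; exact: CkN.
under eq_fun do rewrite cImN; exact: CkN.
Qed.

Lemma smoothM U f g : open U -> smooth U f -> smooth U g ->
  smooth U (fun z => f z * g z).
Proof.
move=> oU Sf Sg k; have [fr fi] := Sf k; have [gr gi] := Sg k; split.
  under eq_fun do rewrite cReM; apply: CkD => //; first exact: CkM.
  by apply: CkN => //; exact: CkM.
by under eq_fun do rewrite cImM; apply: CkD => //; exact: CkM.
Qed.

Lemma smooth_conj U f : open U -> smooth U f -> smooth U (fun z => (f z)^*).
Proof.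
move=> oU Sf k; have [fr fi] := Sf k; split.
  by under eq_fun do rewrite cRe_conj.
by under eq_fun do rewrite cIm_conj; exact: CkN.
Qed.

Lemma smooth_sum (I : Type) (r : seq I) U (F : I -> E -> C) : open U ->
  (forall i, smooth U (F i)) -> smooth U (fun z => \sum_(i <- r) F i z).
Proof.
move=> oU SF; elim: r => [|i r IH].
  by under eq_fun do rewrite big_nil; exact: smooth_cst.
by under eq_fun do rewrite big_cons; exact: smoothD.
Qed.

Lemma smooth_prod (I : Type) (r : seq I) U (F : I -> E -> C) : open U ->
  (forall i, smooth U (F i)) -> smooth U (fun z => \prod_(i <- r) F i z).
Proof.
move=> oU SF; elim: r => [|i r IH].
  by under eq_fun do rewrite big_nil; exact: smooth_cst.
by under eq_fun do rewrite big_cons; exact: smoothM.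
Qed.

Lemma smooth_cderive U f v : smooth U f -> smooth U (cderive v f).
Proof. by move=> Sf k; have [fr fi] := Sf k.+1; split; apply: Ck_derive. Qed.

(** With [wsign] and [base] the two kinds of Wirtinger derivatives are one
    formula, (d/dx + wsign d/dy) / 2, see [pdE]. *)
Definition wsign A : C := if A is inl _ then - 'i else 'i.
Definition base A : 'I_n := match A with inl i => i | inr i => i end.
Definition bar A : idx n := match A with inl i => inr i | inr i => inl i end.

Lemma pdE A f z : pd A f z =
  (cderive (ex R (base A)) f z + wsign A * cderive (ey R (base A)) f z) / 2.
Proof. by case: A => i; rewrite /pd /wsign //= mulNr. Qed.

Lemma wsign_bar A : wsign (bar A) = (wsign A)^*.
Proof. by case: A => i; rewrite /= ?rmorphN/= conj_i ?opprK. Qed.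

Lemma base_bar A : base (bar A) = base A. Proof. by case: A. Qed.

Lemma eq_pd U f g A z : open U -> (forall w, U w -> f w = g w) -> U z ->
  pd A f z = pd A g z.
Proof.
move=> oU fg Uz.
have D v : cderive v f z = cderive v g z.
  rewrite /cderive; congr Complex.
    by apply: (derive_eq_in v oU) Uz => w /fg ->.
  by apply: (derive_eq_in v oU) Uz => w /fg ->.
by rewrite !pdE !D.
Qed.

Lemma smooth_pd U f A : open U -> smooth U f -> smooth U (pd A f).
Proof.
move=> oU Sf; apply: (eq_smooth oU (f := fun z => (cderive (ex R (base A)) f z
  + wsign A * cderive (ey R (base A)) f z) * 2^-1)) => [z _|]; first by rewrite pdE.
apply: smoothM => //; last exact: smooth_cst.
apply: smoothD => //; first exact: smooth_cderive.
by apply: smoothM => //; [exact: smooth_cst|exact: smooth_cderive].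
Qed.

Section Rules.
Variables (U : set E) (z : E).
Hypotheses (oU : open U) (Uz : U z).

Lemma pd_cst A (c : C) : pd A (fun=> c) z = 0.
Proof. by rewrite pdE !(cderive_val (is_cderive_cst _ c z)) mulr0 addr0 mul0r. Qed.

Lemma pdD A f g : smooth U f -> smooth U g ->
  pd A (fun w => f w + g w) z = pd A f z + pd A g z.
Proof.
move=> Sf Sg; have D v := cderive_val (is_cderiveD (smooth_cderivable v Sf Uz)
  (smooth_cderivable v Sg Uz)).
by rewrite !pdE !D -mulrDl; congr (_ / _); rewrite mulrDr addrACA.
Qed.

Lemma pdN A f : smooth U f -> pd A (fun w => - f w) z = - pd A f z.
Proof.
move=> Sf; have D v := cderive_val (is_cderiveN (smooth_cderivable v Sf Uz)).
by rewrite !pdE !D mulrN -opprD mulNr.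
Qed.

Lemma pdB A f g : smooth U f -> smooth U g ->
  pd A (fun w => f w - g w) z = pd A f z - pd A g z.
Proof. by move=> Sf Sg; rewrite pdD ?pdN//; exact: smoothN. Qed.

Lemma pdM A f g : smooth U f -> smooth U g ->
  pd A (fun w => f w * g w) z = pd A f z * g z + f z * pd A g z.
Proof.
move=> Sf Sg; have D v := cderive_val (is_cderiveM (smooth_cderivable v Sf Uz)
  (smooth_cderivable v Sg Uz)).
rewrite !pdE !D.
move: (cderive _ f z) (cderive _ g z) (cderive _ f z) (cderive _ g z) => a b c d.
by move: (f z) (g z) (wsign A) => p q k; ring.
Qed.

Lemma pdZ A (c : C) f : smooth U f -> pd A (fun w => c * f w) z = c * pd A f z.
Proof. by move=> Sf; rewrite pdM ?pd_cst ?mul0r ?add0r//; exact: smooth_cst. Qed.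

Lemma pd_conj A f : smooth U f ->
  pd A (fun w => (f w)^*) z = (pd (bar A) f z)^*.
Proof.
move=> Sf; have D v := cderive_val (is_cderive_conj (smooth_cderivable v Sf Uz)).
rewrite !pdE !D base_bar wsign_bar !rmorphM/= rmorphD/= rmorphM/= conjCK.
by rewrite fmorphV/= conj2.
Qed.

Lemma pd_sum (I : Type) (r : seq I) A (F : I -> E -> C) :
  (forall i, smooth U (F i)) ->
  pd A (fun w => \sum_(i <- r) F i w) z = \sum_(i <- r) pd A (F i) z.
Proof.
move=> SF; elim: r => [|i r IH].
  by under eq_fun do rewrite big_nil; rewrite big_nil pd_cst.
under eq_fun do rewrite big_cons; rewrite big_cons pdD// ?IH//.
exact: smooth_sum.
Qed.

Lemma cderive_swap f v w : smooth U f ->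
  cderive v (cderive w f) z = cderive w (cderive v f) z.
Proof.
move=> Sf; have [fr fi] := Sf 2%N.
rewrite /cderive/=; have -> := Ck_schwarz w v oU fr Uz.
by have -> := Ck_schwarz w v oU fi Uz.
Qed.

Lemma pd_swap f A B : smooth U f -> pd A (pd B f) z = pd B (pd A f) z.
Proof.
move=> Sf.
have D v A' : cderive v (pd A' f) z =
    (cderive v (cderive (ex R (base A')) f) z
      + wsign A' * cderive v (cderive (ey R (base A')) f) z) / 2.
  have S1 := smooth_cderivable v (smooth_cderive (ex R (base A')) Sf) Uz.
  have S2 := smooth_cderivable v (smooth_cderive (ey R (base A')) Sf) Uz.
  have -> : pd A' f = fun z => (cderive (ex R (base A')) f z
      + wsign A' * cderive (ey R (base A')) f z) * 2^-1.
    by apply/funext => y; rewrite pdE.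
  rewrite (cderive_val (is_cderiveM (is_cderiveD S1
     (is_cderiveM (is_cderive_cst v (wsign A') z) S2)) (is_cderive_cst v 2^-1 z))).
  by rewrite mul0r add0r mulr0 addr0.
rewrite pdE !D [RHS]pdE !D.
rewrite (cderive_swap (ex R (base A)) (ex R (base B)) Sf).
rewrite (cderive_swap (ex R (base A)) (ey R (base B)) Sf).
rewrite (cderive_swap (ey R (base A)) (ex R (base B)) Sf).
rewrite (cderive_swap (ey R (base A)) (ey R (base B)) Sf).
move: (cderive _ _ z) (cderive _ _ z) (cderive _ _ z) (cderive _ _ z) => a b c d.
by move: (wsign A) (wsign B) => p q; ring.
Qed.

End Rules.
End ComplexCalculus.

(** * Wirtinger derivatives of a composition *)

Section ChainC.
Variables (R : realType) (n : nat).
Local Notation E := (Cn R n).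
Local Notation C := R[i].
Variables (U V : set E) (T : E -> E).
Hypotheses (oU : open U) (oV : open V) (UV : forall z, U z -> V (T z)).
Hypothesis cT : forall z, U z -> {for z, continuous T}.
Hypothesis sT : forall i, smooth U (fun z => zcoord (inl i) (T z)).

(** By the chain rule a derivative of f o T is a sum of products of derivatives
    of T with (D f) o T, and the induction applies to D f. *)
Lemma Ck_comp k (f : E -> R) : Ck k V f -> Ck k U (fun z => f (T z)).
Proof.
have T1 l i : Ck l U (fun z => (T z).1 0 i) by have [] := sT i l.
have T2 l i : Ck l U (fun z => (T z).2 0 i) by have [] := sT i l.
have S l (F : 'I_n -> E -> R) : (forall i, Ck l U (F i)) ->
    Ck l U (fun z => \sum_i F i z).
  move=> CF; elim: (index_enum _) => [|i r IH].
    by under eq_fun do rewrite big_nil; exact: Ck_cst.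
  by under eq_fun do rewrite big_cons; apply: CkD.
have Cc l f' : Ck l V f' -> forall z, U z -> {for z, continuous (fun z => f' (T z))}.
  move=> Cf z Uz; apply: continuous_comp; first exact: cT.
  exact: Ck_continuous Cf (UV Uz).
elim: k f => [|k IH] f Cf; split=> //; do ?[exact: (Cc _ _ Cf)].
move=> v.
have D z (Uz : U z) : is_derive z v (fun z => f (T z))
   (\sum_i 'D_v (fun w => (T w).1 0 i) z * 'D_(ex R i) f (T z)
    + \sum_i 'D_v (fun w => (T w).2 0 i) z * 'D_(ey R i) f (T z)).
  apply: is_derive_chain oV (Ck_leq _ Cf) (UV Uz) (cT Uz) _ _ => // i.
    exact/derivableP/(Ck_derivable (T1 1%N i) Uz).
  exact/derivableP/(Ck_derivable (T2 1%N i) Uz).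
split=> [z Uz|]; first exact: (@ex_derive _ _ _ _ _ _ _ (D z Uz)).
apply: (eq_Ck oU) (_ : Ck k U (fun z =>
    \sum_i 'D_v (fun w => (T w).1 0 i) z * 'D_(ex R i) f (T z)
    + \sum_i 'D_v (fun w => (T w).2 0 i) z * 'D_(ey R i) f (T z))) => [z Uz|].
  by rewrite (@derive_val _ _ _ _ _ _ _ (D z Uz)).
apply: CkD => //; apply: S => i; apply: CkM => //.
- exact: Ck_derive (T1 _ _).
- exact: (IH ('D_(ex R i) f) (Ck_derive _ Cf)).
- exact: Ck_derive (T2 _ _).
- exact: (IH ('D_(ey R i) f) (Ck_derive _ Cf)).
Qed.

Lemma smooth_comp (f : E -> C) : smooth V f -> smooth U (fun z => f (T z)).
Proof.
move=> Sf k; have [fr fi] := Sf k.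
by split; [exact: (Ck_comp fr)|exact: (Ck_comp fi)].
Qed.

(** The real coefficients of the chain rule are the real and imaginary parts of
    a = D_v (T^i); writing them as (a + conj a) / 2 and (a - conj a) / 2i
    regroups the real partial derivatives of f into Wirtinger ones. *)
Lemma cderive_comp (f : E -> C) z v : U z -> smooth V f ->
  cderive v (fun z => f (T z)) z =
    \sum_i (cderive v (fun w => zcoord (inl i) (T w)) z * pd (inl i) f (T z)
      + (cderive v (fun w => zcoord (inl i) (T w)) z)^* * pd (inr i) f (T z)).
Proof.
move=> Uz Sf; have [fr fi] := Sf 1%N.
have T1 i : is_derive z v (fun w => (T w).1 0 i) ('D_v (fun w => (T w).1 0 i) z).
  by apply/derivableP; have [C1 _] := sT i 1%N; exact: (Ck_derivable C1 Uz).
have T2 i : is_derive z v (fun w => (T w).2 0 i) ('D_v (fun w => (T w).2 0 i) z).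
  by apply/derivableP; have [_ C2] := sT i 1%N; exact: (Ck_derivable C2 Uz).
have Dr := is_derive_chain oV fr (UV Uz) (cT Uz) T1 T2.
have Di := is_derive_chain oV fi (UV Uz) (cT Uz) T1 T2.
rewrite {1}/cderive (@derive_val _ _ _ _ _ _ _ Dr) (@derive_val _ _ _ _ _ _ _ Di).
transitivity (\sum_i (('D_v (fun w => (T w).1 0 i) z)%:C%C * cderive (ex R i) f (T z)
   + ('D_v (fun w => (T w).2 0 i) z)%:C%C * cderive (ey R i) f (T z))).
  exact: (complex_lin (index_enum _) (fun i => 'D_v (fun w => (T w).1 0 i) z)
    (fun i => 'D_v (fun w => (T w).2 0 i) z) (fun i => cderive (ex R i) f (T z))
    (fun i => cderive (ey R i) f (T z))).
apply: eq_bigr => i _; rewrite !pdE /=.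
set a := cderive v _ z.
have -> : ('D_v (fun w => (T w).1 0 i) z)%:C%C = (a + a^*) / 2.
  by rewrite -ReJ_add.
have -> : ('D_v (fun w => (T w).2 0 i) z)%:C%C = (a^* - a) / 2 * 'i.
  by rewrite -complexiE -ImJ_sub.
move: a a^* (cderive _ f _) (cderive _ f _) => a b X Y.
ring.
Qed.

Lemma pd_comp (f : E -> C) z A : U z -> smooth V f ->
  pd A (fun z => f (T z)) z =
    \sum_i (pd A (fun w => zcoord (inl i) (T w)) z * pd (inl i) f (T z)
      + (pd (bar A) (fun w => zcoord (inl i) (T w)) z)^* * pd (inr i) f (T z)).
Proof.
move=> Uz Sf; rewrite pdE !cderive_comp// mulr_sumr -big_split mulr_suml.
apply: eq_bigr => i _.
move: (pd (inl i) f _) (pd (inr i) f _) => p q.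
rewrite (pdE A) (pdE (bar A)) base_bar wsign_bar.
rewrite !rmorphM/= rmorphD/= rmorphM/= conjCK fmorphV/= conj2.
move: (cderive _ _ z) (cderive _ _ z) => a b.
move: (a^*) (b^*) (wsign R A) => a' b' k.
ring.
Qed.

End ChainC.

(** * Determinants, traces and Levi forms *)

Section LinearAlgebra.
Variables (C : numClosedFieldType) (n : nat).
Implicit Types A J G P : 'M[C]_n.

Lemma hermitian_form_mx A (v : 'rV[C]_n) :
  \sum_(i < n) \sum_(j < n) A i j * v 0 i * (v 0 j)^* =
  (v *m A *m (map_mx Num.conj v^T)) 0 0.
Proof.
rewrite mxE exchange_big; apply: eq_bigr => j _.
rewrite !mxE mulr_suml; apply: eq_bigr => i _.
by rewrite [A i j * _]mulrC.
Qed.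

(** The metric enters the Ricci form through log det g, where the logarithm is
    only meaningful at a positive argument.  A unitary diagonalization exhibits
    each eigenvalue as the value of the form on an eigenvector. *)
Lemma det_posdef A : (forall i j, A j i = (A i j)^*) ->
  (forall v : 'rV[C]_n, v != 0 ->
    0 < \sum_(i < n) \sum_(j < n) A i j * v 0 i * (v 0 j)^*) -> 0 < \det A.
Proof.
move=> hA pA.
have AT : map_mx Num.conj A^T = A by apply/matrixP => i j; rewrite !mxE -hA.
have nA : A \is normalmx by apply/normalmxP; rewrite AT.
have /orthomx_spectralP := nA.
set Q := spectralmx A; set sp := spectral_diag A => AE.
have uQ : Q \is unitarymx := spectral_unitarymx A.
have Qu : Q \in unitmx := unitarymx_unit uQ.
have sp0 i : 0 < sp 0 i.
  have := pA (row i Q); rewrite hermitian_form_mx => /(_ _)/wrap[].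
    apply/eqP => r0; have : delta_mx 0 i *m Q = 0 :> 'rV_n by rewrite -rowE.
    move=> /(congr1 (mulmx^~ (invmx Q))); rewrite mulmxK// mul0mx.
    by move=> /matrixP/(_ 0 i)/eqP; rewrite !mxE !eqxx oner_eq0.
  have -> : (row i Q *m A *m map_mx Num.conj (row i Q)^T) 0 0
      = (Q *m A *m map_mx Num.conj Q^T) i i.
    rewrite -row_mul [LHS]mxE [RHS]mxE; apply: eq_bigr => k _.
    by congr (_ * _); rewrite !mxE.
  rewrite -invmx_unitary// AE !mulmxA mulmxV// mul1mx.
  by rewrite -mulmxA mulmxV// mulmx1 mxE eqxx.
rewrite AE !det_mulmx det_inv det_diag mulrAC mulVr ?mul1r; last by rewrite -unitmxE.
by apply: prodr_gt0.
Qed.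

(** The trace of one sesquilinear form with respect to another does not depend
    on the coordinates: a change of coordinates multiplies both by J on the left
    and K on the right. *)
Lemma mxtrace_congr G P G' P' J K :
  G = J *m G' *m K -> P = J *m P' *m K -> G \in unitmx ->
  \tr (invmx G *m P) = \tr (invmx G' *m P').
Proof.
move=> GE PE Gu; have := Gu; rewrite GE !unitmx_mul => /andP[/andP[Ju Gu'] Ku].
have -> : invmx (J *m G' *m K) *m P = invmx K *m (invmx G' *m P' *m K).
  rewrite -GE; apply: (can_inj (mulKmx Gu)); rewrite mulKVmx// {1}GE PE.
  by rewrite -!mulmxA (mulKVmx Ku) (mulKVmx Gu').
by rewrite mxtrace_mulC mulmxK.
Qed.

End LinearAlgebra.

Section Jacobi.
Variables (R : realType) (n m : nat).
Local Notation E := (Cn R n).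
Local Notation C := R[i].
Variables (U : set E) (z : E).
Hypotheses (oU : open U) (Uz : U z).

Lemma pd_prod (I : eqType) (r : seq I) A (F : I -> E -> C) :
  (forall i, smooth U (F i)) -> uniq r ->
  pd A (fun w => \prod_(i <- r) F i w) z =
    \sum_(i <- r) pd A (F i) z * \prod_(j <- r | j != i) F j z.
Proof.
move=> SF; elim: r => [_|i r IH /= /andP[ir ur]].
  by under eq_fun do rewrite big_nil; rewrite big_nil pd_cst.
under eq_fun do rewrite big_cons.
rewrite (pdM Uz) ?IH ?big_cons//; last exact: smooth_prod.
rewrite eqxx/=; congr (_ * _ + _).
  rewrite [LHS]big_seq_cond [RHS]big_seq_cond; apply: eq_bigl => j.
  by case jr: (j \in r) => //=; apply/esym; apply: contraNneq ir => <-.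
rewrite mulr_sumr [LHS]big_seq [RHS]big_seq; apply: eq_bigr => j jr.
rewrite big_cons; have -> : i != j by apply: contraNneq ir => ->.
by rewrite mulrCA.
Qed.

Variable G : E -> 'M[C]_m.
Hypothesis sG : forall i j, smooth U (fun w => G w i j).

Lemma smooth_det : smooth U (fun w => \det (G w)).
Proof.
apply: smooth_sum => // s; apply: smoothM => //; first exact: smooth_cst.
exact: smooth_prod.
Qed.

(** Jacobi's formula.  By the Leibniz rule the derivative is the sum over i of
    the determinants in which row i is differentiated; expanding each along
    that row produces the cofactors of G. *)
Lemma pd_det A : pd A (fun w => \det (G w)) z =
  \tr (\adj (G z) *m \matrix_(i, j) pd A (fun w => G w i j) z).
Proof.
pose M i := \matrix_(k, l) (if k == i then pd A (fun w => G w i l) z else G z k l).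
have detM i : \det (M i) = \sum_j pd A (fun w => G w i j) z * cofactor (G z) i j.
  rewrite (expand_det_row _ i); apply: eq_bigr => j _.
  rewrite mxE eqxx; congr (_ * (_ * \det _)); apply/matrixP => k l.
  by rewrite !mxE eq_sym (negbTE (neq_lift _ _)).
transitivity (\sum_i \det (M i)).
  rewrite (pd_sum oU Uz) => [|s]; last first.
    by apply: smoothM => //; [exact: smooth_cst|exact: smooth_prod].
  rewrite exchange_big; apply: eq_bigr => s _.
  rewrite (pdZ Uz) -?mulr_sumr; last exact: smooth_prod.
  rewrite pd_prod ?index_enum_uniq//; congr (_ * _); apply: eq_bigr => i _.
  rewrite [RHS](bigD1 i)//= mxE eqxx; congr (_ * _); apply: eq_bigr => j ji.
  by rewrite mxE (negbTE ji).
under eq_bigr do rewrite detM.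
rewrite exchange_big /mxtrace; apply: eq_bigr => j _.
rewrite mxE; apply: eq_bigr => i _.
by rewrite !mxE mulrC.
Qed.

Lemma pd_ln (d : E -> C) A : smooth U d ->
  (forall w, U w -> complex.Im (d w) = 0 /\ 0 < complex.Re (d w)) ->
  pd A (fun w => (ln (complex.Re (d w)))%:C%C) z = (d z)^-1 * pd A d z.
Proof.
move=> Sd dp; have [dr di] := Sd 1%N.
have D v : cderive v (fun w => (ln (complex.Re (d w)))%:C%C) z = (d z)^-1 * cderive v d z.
  have L := is_derive_ln (f := fun w => complex.Re (d w)) (dp _ Uz).2
    (Ck_derivable (v := v) dr Uz).
  rewrite {1}/cderive /= (@derive_val _ _ _ _ _ _ _ L) derive_cst.
  have -> : d z = (complex.Re (d z))%:C%C.
    by apply: complex_ext => //; rewrite (dp _ Uz).1.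
  have -> : ((complex.Re (d z))%:C%C)^-1 = ((complex.Re (d z))^-1)%:C%C.
    by rewrite fmorphV.
  have I0 : 'D_v (fun w => complex.Im (d w)) z = 0.
    rewrite (@derive_eq_in _ _ U _ (fun=> 0) z v oU) ?derive_cst// => w Uw.
    exact: (dp w Uw).1.
  apply: complex_ext; rewrite ?cReZ ?cImZ//=.
  by rewrite I0 mulr0.
by rewrite !pdE !D [wsign R A * _]mulrCA -mulrDr mulrA.
Qed.

Lemma smooth_ln (d : E -> C) : smooth U d -> (forall w, U w -> 0 < complex.Re (d w)) ->
  smooth U (fun w => (ln (complex.Re (d w)))%:C%C).
Proof.
by move=> Sd dp k; have [dr di] := Sd k; split; [exact: Ck_ln|exact: Ck_cst].
Qed.

End Jacobi.

Section Levi.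
Variables (R : realType) (n : nat).
Local Notation E := (Cn R n).
Local Notation C := R[i].
Variables (U : set E) (z : E) (Phi : E -> C).
Hypotheses (oU : open U) (Uz : U z) (sPhi : smooth U Phi).
Hypothesis maxPhi : exists2 r : R, 0 < r &
  forall y, `|y| < r -> complex.Re (Phi (z + y)) <= complex.Re (Phi z).

Lemma max_line (v : E) : exists2 r : R, 0 < r & forall t : R, `|t| < r ->
  complex.Re (Phi (z + t *: v)) <= complex.Re (Phi z).
Proof.
case: maxPhi => r r0 Hr; exists (r / (`|v| + 1)); first by rewrite divr_gt0// ltr_wpDl.
move=> t; rewrite ltr_pdivlMr ?ltr_wpDl// => tr; apply: Hr; rewrite normrZ.
by apply: le_lt_trans tr; rewrite ler_wpM2l// lerDl.
Qed.

Lemma max_pd A : (forall w, U w -> complex.Im (Phi w) = 0) -> pd A Phi z = 0.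
Proof.
move=> im0; have [pr pi] := sPhi 1%N.
have D v : cderive v Phi z = 0.
  apply: complex_ext => /=.
    apply: (@local_max_derive R E (fun w => complex.Re (Phi w))); last exact: max_line.
    exact: Ck_derivable pr Uz.
  rewrite (@derive_eq_in _ _ U _ (fun=> 0) z v oU) ?derive_cst// => w Uw.
by rewrite pdE !D mulr0 addr0 mul0r.
Qed.

(** The real tangent vectors of C^n underlying v and iv. *)
Definition real_vec (v : 'rV[C]_n) : E :=
  (map_mx (@complex.Re R) v, map_mx (@complex.Im R) v).
Definition real_ivec (v : 'rV[C]_n) : E :=
  (- map_mx (@complex.Im R) v, map_mx (@complex.Re R) v).

Lemma cderive_lin f w (y : E) : smooth U f -> U w ->
  cderive y f w = \sum_i ((y.1 0 i)%:C%C * cderive (ex R i) f w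
     + (y.2 0 i)%:C%C * cderive (ey R i) f w).
Proof.
move=> Sf Uw; have [fr fi] := Sf 1%N.
rewrite {1}/cderive (@derive_val _ _ _ _ _ _ _ (is_derive_lin y oU fr Uw)).
rewrite (@derive_val _ _ _ _ _ _ _ (is_derive_lin y oU fi Uw)).
exact: (complex_lin (index_enum _) (fun i => y.1 0 i) (fun i => y.2 0 i)
  (fun i => cderive (ex R i) f w) (fun i => cderive (ey R i) f w)).
Qed.

Lemma sum_pd (v : 'rV[C]_n) f w : smooth U f -> U w ->
  \sum_i v 0 i * pd (inl i) f w
    = (cderive (real_vec v) f w - 'i * cderive (real_ivec v) f w) / 2.
Proof.
move=> Sf Uw; rewrite !cderive_lin// mulr_sumr -sumrB mulr_suml.
apply: eq_bigr => i _; rewrite /real_vec /real_ivec /= pdE/= !mxE.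
rewrite {1}[v 0 i]complexE complexiE.
have -> : (- complex.Im (v 0 i))%:C%C = - (complex.Im (v 0 i))%:C%C :> C.
  by rewrite rmorphN.
move: (_%:C%C) (_%:C%C) (cderive _ f w) (cderive _ f w) => b a d c.
have ii : 'i * 'i = -1 :> C by rewrite -expr2 sqrCi.
transitivity ((a * c + b * d - 'i * (a * d - b * c) - ('i * 'i + 1) * b * d) / 2).
  by field.
by rewrite ii; field.
Qed.

Lemma sum_pdbar (v : 'rV[C]_n) f w : smooth U f -> U w ->
  \sum_i (v 0 i)^* * pd (inr i) f w
    = (cderive (real_vec v) f w + 'i * cderive (real_ivec v) f w) / 2.
Proof.
move=> Sf Uw.
have Sc := smooth_conj oU Sf.
transitivity (\sum_i v 0 i * pd (inl i) (fun w => (f w)^*) w)^*.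
  rewrite rmorph_sum; apply: eq_bigr => i _.
  by rewrite rmorphM/= (pd_conj Uw)// conjCK.
rewrite sum_pd// !(cderive_val (is_cderive_conj (smooth_cderivable _ Sf Uw))).
move: (cderive _ f w) (cderive _ f w) => a b.
by rewrite rmorphM/= rmorphB/= rmorphM/= !conjCK conj_i mulNr opprK fmorphV/= conj2.
Qed.

(** In the complex line spanned by v the Levi form is a quarter of the
    Laplacian, the sum of the second derivatives along v and iv. *)
Lemma max_levi (v : 'rV[C]_n) :
  complex.Re (\sum_i \sum_j v 0 i * (v 0 j)^* * pd (inl i) (pd (inr j) Phi) z) <= 0.
Proof.
have Sj j : smooth U (pd (inr j) Phi) by exact: smooth_pd.
have -> : \sum_i \sum_j v 0 i * (v 0 j)^* * pd (inl i) (pd (inr j) Phi) z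
  = (cderive (real_vec v) (cderive (real_vec v) Phi) z
     + cderive (real_ivec v) (cderive (real_ivec v) Phi) z) / 4.
  pose Psi w := (cderive (real_vec v) Phi w + 'i * cderive (real_ivec v) Phi w) * 2^-1.
  have S1 := smooth_cderive (real_vec v) sPhi.
  have S2 := smooth_cderive (real_ivec v) sPhi.
  have SPsi : smooth U Psi.
    apply: smoothM => //; last exact: smooth_cst.
    by apply: smoothD => //; apply: smoothM => //; exact: smooth_cst.
  have Dpsi y : cderive y Psi z = (cderive y (cderive (real_vec v) Phi) z
       + 'i * cderive y (cderive (real_ivec v) Phi) z) / 2.
    have C1 := smooth_cderivable y S1 Uz; have C2 := smooth_cderivable y S2 Uz.
    rewrite (cderive_val (is_cderiveM (is_cderiveD C1
     (is_cderiveM (is_cderive_cst y 'i z) C2)) (is_cderive_cst y 2^-1 z))).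
    by rewrite mul0r add0r mulr0 addr0.
  have PsiE w (Uw : U w) : Psi w = \sum_j (v 0 j)^* * pd (inr j) Phi w.
    by rewrite sum_pdbar.
  clearbody Psi.
  have dPsi i : pd (inl i) Psi z = \sum_j (v 0 j)^* * pd (inl i) (pd (inr j) Phi) z.
    pose F j w := (v 0 j)^* * pd (inr j) Phi w.
    have SF j : smooth U (F j) by apply: smoothM => //; exact: smooth_cst.
    transitivity (pd (inl i) (fun w => \sum_j F j w) z).
      exact: (eq_pd (inl i) oU PsiE Uz).
    rewrite (pd_sum oU Uz _ _ SF); apply: eq_bigr => j _.
    exact: (pdZ Uz).
  transitivity (\sum_i v 0 i * pd (inl i) Psi z).
    apply: eq_bigr => i _; rewrite dPsi mulr_sumr.
    by apply: eq_bigr => j _; exact: esym (mulrA _ _ _).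
  rewrite sum_pd// !Dpsi (cderive_swap oU Uz (real_ivec v) (real_vec v))//.
  move: (cderive _ _ z) (cderive _ _ z) (cderive _ _ z) => a b c.
  have ii : 'i * 'i = -1 :> C by rewrite -expr2 sqrCi.
  transitivity ((c - ('i * 'i) * a) / 4); first by field.
  by rewrite ii; field.
have [pr pi] := sPhi 2%N.
have le y : complex.Re (cderive y (cderive y Phi) z) <= 0.
  apply: (@local_max_derive2 R E U (fun w => complex.Re (Phi w)) z y oU Uz).
  - by move=> w Uw; exact: (Ck_derivable pr Uw).
  - exact: (Ck_derivable (Ck_derive y pr) Uz).
  - exact: max_line.
have -> : (4 : C)^-1 = (4^-1)%:C%C by rewrite fmorphV rmorph_nat.
rewrite mulrC cReZ cReD pmulr_rle0 ?invr_gt0//.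
by rewrite -[leRHS]addr0 lerD.
Qed.

End Levi.

(** * Soliton identities in one chart *)

Section LocalSoliton.
Variables (R : realType) (n : nat).
Local Notation E := (Cn R n).
Local Notation C := R[i].
Variables (U : set E) (G : E -> 'M[C]_n) (V : E -> 'I_n -> C).
Hypotheses (oU : open U).
Hypothesis sG : forall i j, smooth U (fun z => G z i j).
Hypothesis hG : forall z, U z -> forall i j, G z j i = (G z i j)^*.
Hypothesis pG : forall z, U z -> forall v : 'rV[C]_n, v != 0 ->
  0 < \sum_(i < n) \sum_(j < n) G z i j * v 0 i * (v 0 j)^*.
Hypothesis hV : forall i, holomorphic U (fun z => V z i).

Definition logdet (z : E) : C := (ln (complex.Re (\det (G z))))%:C%C.
Definition Ric (z : E) : 'M[C]_n :=
  \matrix_(i, j) - pd (inl i) (pd (inr j) logdet) z.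
Definition scal (z : E) : C := 2 * \tr (invmx (G z) *m Ric z).

Hypothesis kah : forall z, U z -> forall i j k,
  pd (inl k) (fun w => G w i j) z = pd (inl i) (fun w => G w k j) z.
Hypothesis sol : forall z, U z -> forall i j,
  Ric z i j - G z i j = \sum_k (V z k * pd (inl k) (fun w => G w i j) z
    + pd (inl i) (fun w => V w k) z * G z k j).
Hypothesis ext : forall i,
  holomorphic U (fun z => \sum_j invmx (G z) j i * pd (inr j) scal z).

(** The obstruction to the Einstein equation, written P in the comments. *)
Definition defect (z : E) : 'M[C]_n := Ric z - G z.
(** The (0,1)-form g(V, .) dual to V. *)
Definition alpha (z : E) (j : 'I_n) : C := \sum_k V z k * G z k j.
Definition sqnorm (z : E) : C := \sum_l V z l * (alpha z l)^*.
Definition trdefect (z : E) : C := \tr (invmx (G z) *m defect z).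
(** The Ricci potential of the soliton up to a constant, see
    [pdbar_potential]. *)
Definition potential (z : E) : C := - (trdefect z + sqnorm z).
Definition grad_sqnorm (z : E) (i : 'I_n) : C :=
  \sum_j invmx (G z) j i * pd (inr j) sqnorm z.

Lemma defectE z i j : defect z i j = Ric z i j - G z i j.
Proof. by rewrite mxE [X in _ + X]mxE. Qed.

Lemma logdet_real z : (logdet z)^* = logdet z.
Proof. by rewrite /logdet; exact: conjc_real. Qed.

Lemma detG_gt0 z : U z -> 0 < \det (G z).
Proof. by move=> Uz; apply: det_posdef; [exact: hG|exact: pG]. Qed.

Lemma detG_real z : U z -> complex.Im (\det (G z)) = 0 /\ 0 < complex.Re (\det (G z)).
Proof. by move=> /detG_gt0; rewrite ltcE => /andP[/eqP ? ?]; split. Qed.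

Lemma unitG z : U z -> G z \in unitmx.
Proof. by move=> /detG_gt0 d0; rewrite unitmxE unitfE gt_eqF. Qed.

Lemma smoothV i : smooth U (fun z => V z i).
Proof. by have [] := hV i. Qed.

Lemma pdbarV z i j : U z -> pd (inr j) (fun w => V w i) z = 0.
Proof. by have [_] := hV i; apply. Qed.

Lemma smooth_logdet : smooth U logdet.
Proof.
apply: smooth_ln => //; first exact: smooth_det.
by move=> w /detG_real[].
Qed.

Lemma smooth_alpha j : smooth U (fun z => alpha z j).
Proof. by apply: smooth_sum => // k; apply: smoothM => //; exact: smoothV. Qed.

Lemma smooth_sqnorm : smooth U sqnorm.
Proof.
apply: smooth_sum => // k; apply: smoothM => //; first exact: smoothV.
by apply: smooth_conj => //; exact: smooth_alpha.
Qed.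

(** The soliton equation in divergence form: closedness of the Kaehler form
    lets the derivative d_k g_ij in the Lie derivative be replaced by
    d_i g_kj, after which the right-hand side is a product rule. *)
Lemma pd_alpha z i j : U z -> pd (inl i) (fun w => alpha w j) z = defect z i j.
Proof.
move=> Uz; rewrite /alpha (pd_sum oU Uz); last first.
  by move=> k; apply: smoothM => //; exact: smoothV.
rewrite defectE sol//; apply: eq_bigr => k _.
by rewrite (pdM Uz)//; [rewrite addrC kah|exact: smoothV].
Qed.

Lemma pd_real f z q : U z -> smooth U f -> (forall w, U w -> (f w)^* = f w) ->
  pd (inl q) f z = (pd (inr q) f z)^*.
Proof.
move=> Uz Sf rf; have /= <- := pd_conj Uz (inl q) Sf.
by apply: (eq_pd _ oU) Uz => w /rf.
Qed.

Lemma Ric_herm z i j : U z -> (Ric z i j)^* = Ric z j i.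
Proof.
move=> Uz; rewrite !mxE rmorphN/=; congr (- _).
have S := smooth_logdet; have Sj := smooth_pd (inr j) oU S.
have Dj w : U w -> (pd (inr j) logdet w)^* = pd (inl j) logdet w.
  by move=> Uw; rewrite (pd_real _ Uw S (fun w _ => logdet_real w)).
have := pd_conj Uz (inr i) Sj; rewrite (eq_pd (inr i) oU Dj Uz) /= => <-.
exact: (pd_swap oU Uz).
Qed.

Lemma defect_herm z i j : U z -> (defect z i j)^* = defect z j i.
Proof. by move=> Uz; rewrite !defectE rmorphB/= -hG// Ric_herm. Qed.

Lemma pd_logdet z A : U z ->
  pd A logdet z = \tr (invmx (G z) *m \matrix_(i, j) pd A (fun w => G w i j) z).
Proof.
move=> Uz; rewrite (pd_ln oU Uz A (smooth_det oU sG) detG_real).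
by rewrite (pd_det oU Uz sG) /invmx unitG// -scalemxAl mxtraceZ.
Qed.

(** This expression of the trace no longer contains the inverse matrix of g,
    which makes it easy to differentiate. *)
Lemma trdefectE z : U z -> trdefect z =
  \sum_k (V z k * pd (inl k) logdet z + pd (inl k) (fun w => V w k) z).
Proof.
move=> Uz; rewrite /trdefect.
have -> : defect z = \sum_k V z k *: (\matrix_(i, j) pd (inl k) (fun w => G w i j) z)
    + (\matrix_(i, k) pd (inl i) (fun w => V w k) z) *m G z.
  apply/matrixP => i j; rewrite defectE sol// big_split.
  rewrite [RHS]mxE; congr (_ + _).
    by rewrite summxE; apply: eq_bigr => k _; rewrite !mxE.
  by rewrite mxE; apply: eq_bigr => k _; rewrite !mxE.
rewrite mulmxDr mxtraceD big_split; congr (_ + _).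
  rewrite mulmx_sumr raddf_sum; apply: eq_bigr => k _ /=.
  by rewrite -scalemxAr mxtraceZ pd_logdet.
rewrite mxtrace_mulC mulmxK ?unitG//.
by apply: eq_bigr => k _; rewrite mxE.
Qed.

Lemma smooth_trdefect : smooth U trdefect.
Proof.
apply: (eq_smooth oU) (fun z Uz => esym (trdefectE Uz)) _.
apply: smooth_sum => // k; apply: smoothD => //.
  apply: smoothM => //; first exact: smoothV.
  by apply: smooth_pd => //; exact: smooth_logdet.
by apply: smooth_pd => //; exact: smoothV.
Qed.

Lemma smooth_potential : smooth U potential.
Proof.
apply: smoothN => //; apply: smoothD => //; first exact: smooth_trdefect.
exact: smooth_sqnorm.
Qed.

Lemma pdbar_sqnorm z q : U z ->
  pd (inr q) sqnorm z = \sum_l V z l * defect z l q.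
Proof.
move=> Uz; rewrite /sqnorm (pd_sum oU Uz); last first.
  move=> l; apply: smoothM => //; first exact: smoothV.
  by apply: smooth_conj => //; exact: smooth_alpha.
apply: eq_bigr => l _; rewrite (pdM Uz); last 2 first.
- exact: smoothV.
- by apply: smooth_conj => //; exact: smooth_alpha.
rewrite pdbarV// mul0r add0r (pd_conj Uz) /=; last exact: smooth_alpha.
by rewrite pd_alpha// defect_herm.
Qed.

(** Only the factors d_k log det g survive d/dzbar^q, V being holomorphic, and
    their derivatives are - Ric_kq = - (g_kq + P_kq). *)
Lemma pdbar_trdefect z q : U z ->
  pd (inr q) trdefect z = - (alpha z q + \sum_l V z l * defect z l q).
Proof.
move=> Uz.
have SL k : smooth U (pd (inl k) logdet) by apply: smooth_pd => //; exact: smooth_logdet.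
have SV k : smooth U (pd (inl k) (fun w => V w k)).
  by apply: smooth_pd => //; exact: smoothV.
have SM k : smooth U (fun w => V w k * pd (inl k) logdet w).
  by apply: smoothM => //; exact: smoothV.
rewrite (eq_pd _ oU trdefectE Uz) (pd_sum oU Uz); last by move=> k; exact: smoothD.
rewrite -big_split -sumrN; apply: eq_bigr => k _.
rewrite (pdD Uz)// (pdM Uz)//; last exact: smoothV.
rewrite pdbarV// mul0r add0r (pd_swap oU Uz); last exact: smooth_logdet.
rewrite [X in _ + X](pd_swap oU Uz); last exact: smoothV.
have -> : pd (inl k) (pd (inr q) (fun w => V w k)) z = 0.
  rewrite (@eq_pd R n U _ (fun=> 0) _ z oU) ?pd_cst// => w Uw.
  exact: pdbarV.
rewrite addr0 /= -mulrDr defectE addrC subrK mxE mulrN opprK//.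
Qed.

(** The terms V^l P_lq contributed by the trace and by |V|^2 cancel. *)
Lemma pdbar_potential z q : U z -> pd (inr q) potential z = alpha z q.
Proof.
move=> Uz; rewrite /potential (pdN Uz); last first.
  by apply: smoothD => //; [exact: smooth_trdefect|exact: smooth_sqnorm].
rewrite (pdD Uz) ?pdbar_trdefect ?pdbar_sqnorm//; last 2 first.
- exact: smooth_trdefect.
- exact: smooth_sqnorm.
by rewrite opprD opprK addrK.
Qed.

Lemma sqnormE z : sqnorm z =
  (\sum_i \sum_j V z i * (V z j)^* * (G z j i)^*).
Proof.
apply: eq_bigr => i _; rewrite /alpha rmorph_sum mulr_sumr; apply: eq_bigr => j _.
by rewrite rmorphM/= mulrA.
Qed.

Lemma sqnorm_form z : U z -> sqnorm z =
  \sum_(i < n) \sum_(j < n) G z i j * V z i * (V z j)^*.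
Proof.
move=> Uz; rewrite sqnormE; apply: eq_bigr => i _; apply: eq_bigr => j _.
by rewrite -hG// mulrC mulrA.
Qed.

Lemma sqnorm_real z : U z -> (sqnorm z)^* = sqnorm z.
Proof.
move=> Uz; rewrite sqnorm_form// rmorph_sum exchange_big; apply: eq_bigr => i _.
rewrite rmorph_sum; apply: eq_bigr => j _.
by rewrite !rmorphM/= conjCK -hG// mulrAC.
Qed.

Lemma sqnorm_ge0 z : U z -> 0 <= sqnorm z.
Proof.
move=> Uz; rewrite sqnorm_form//.
have [v0|v0] := eqVneq (\row_i V z i : 'rV[C]_n) 0.
  rewrite big1// => i _; rewrite big1// => j _.
  by move/matrixP/(_ 0 i): v0; rewrite !mxE => ->; rewrite mulr0 mul0r.
rewrite ltW//; have := pG Uz v0.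
by under eq_bigr do under eq_bigr do rewrite !mxE.
Qed.

Lemma sqnorm_eq0 z i : U z -> sqnorm z = 0 -> V z i = 0.
Proof.
move=> Uz u0; have [v0|v0] := eqVneq (\row_i V z i : 'rV[C]_n) 0.
  by move/matrixP/(_ 0 i): v0; rewrite !mxE.
have := pG Uz v0.
under eq_bigr do under eq_bigr do rewrite !mxE.
by rewrite -sqnorm_form// u0 ltxx.
Qed.

Lemma trdefect_real z : U z -> (trdefect z)^* = trdefect z.
Proof.
move=> Uz; rewrite /trdefect -trace_map_mx map_mxM map_invmx.
have -> : map_mx Num.conj (G z) = (G z)^T.
  by apply/matrixP => i j; rewrite !mxE -hG.
have -> : map_mx Num.conj (defect z) = (defect z)^T.
  by apply/matrixP => i j; rewrite mxE [RHS]mxE defect_herm.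
by rewrite -trmx_inv -trmx_mul mxtrace_tr mxtrace_mulC.
Qed.

Lemma potential_real z : U z -> (potential z)^* = potential z.
Proof. by move=> Uz; rewrite rmorphN/= rmorphD/= trdefect_real// sqnorm_real. Qed.

Lemma alpha_inv z i : U z -> \sum_j invmx (G z) j i * alpha z j = V z i.
Proof.
move=> Uz; have -> : V z i = ((\row_k V z k) *m G z *m invmx (G z)) 0 i.
  by rewrite mulmxK ?unitG// mxE.
rewrite mxE; apply: eq_bigr => j _; rewrite mulrC; congr (_ * _).
by rewrite mxE; apply: eq_bigr => k _; rewrite mxE.
Qed.

Lemma grad_sqnorm_G z j : U z -> \sum_i grad_sqnorm z i * G z i j = pd (inr j) sqnorm z.
Proof.
move=> Uz; have -> : pd (inr j) sqnorm z =
    ((\row_k pd (inr k) sqnorm z) *m invmx (G z) *m G z) 0 j.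
  by rewrite mulmxKV ?unitG// mxE.
rewrite mxE; apply: eq_bigr => i _; congr (_ * _).
by rewrite mxE; apply: eq_bigr => k _; rewrite mxE mulrC.
Qed.

Lemma scalE z : U z -> scal z = 2 * (trdefect z + n%:R).
Proof.
move=> Uz; rewrite /scal /trdefect; congr (_ * _).
rewrite -[Ric z](subrK (G z)) mulmxDr mxtraceD mulVmx ?unitG//.
by rewrite mxtrace1.
Qed.

Lemma pdbar_scal z q : U z ->
  pd (inr q) scal z = - (2 * (alpha z q + pd (inr q) sqnorm z)).
Proof.
move=> Uz; rewrite (eq_pd _ oU scalE Uz) (pdZ Uz); last first.
  by apply: smoothD => //; [exact: smooth_trdefect|exact: smooth_cst].
rewrite (pdD Uz) ?pd_cst; [|exact: smooth_trdefect|exact: smooth_cst].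
by rewrite addr0 pdbar_trdefect// pdbar_sqnorm// mulrN.
Qed.

(** Since s = 2 (n - F - |V|^2) and gradC F = V. *)
Lemma grad_sqnormE z i : U z -> grad_sqnorm z i =
  - V z i - 2^-1 * \sum_j invmx (G z) j i * pd (inr j) scal z.
Proof.
move=> Uz; rewrite -(alpha_inv i Uz) mulr_sumr -sumrN -sumrB.
apply: eq_bigr => j _; rewrite pdbar_scal//.
move: (invmx _ _ _) (alpha _ _) (pd _ _ _) => a b c.
by field.
Qed.

Lemma grad_sqnorm_holomorphic i : holomorphic U (fun z => grad_sqnorm z i).
Proof.
have [S0 H0] := ext i; have [S1 H1] := hV i.
have S3 : smooth U (fun z => 2^-1 * \sum_j invmx (G z) j i * pd (inr j) scal z).
  by apply: smoothM => //; exact: smooth_cst.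
have S2 : smooth U (fun z => - V z i) by exact: smoothN.
split=> [|j z Uz].
  apply: (eq_smooth oU) (fun z Uz => esym (grad_sqnormE i Uz)) _.
  by apply: smoothD => //; exact: smoothN.
rewrite (eq_pd _ oU (fun w Uw => grad_sqnormE i Uw) Uz) (pdB oU Uz)// (pdN Uz)//.
by rewrite (pdZ Uz)// H0// H1// mulr0 subr0 oppr0.
Qed.

(** With W = gradC |V|^2 this reads Vbar |V|^2 = Wbar F.  Both sides equal
    V |V|^2: the left one because V |V|^2 = P(V, Vbar) is real, the right one by
    the definition of W. *)
Lemma V_sqnorm z : U z ->
  \sum_j (V z j)^* * pd (inr j) sqnorm z = \sum_j (grad_sqnorm z j)^* * alpha z j.
Proof.
move=> Uz.
transitivity (\sum_k V z k * pd (inl k) sqnorm z).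
  transitivity (\sum_j \sum_l (V z j)^* * V z l * defect z l j).
    apply: eq_bigr => j _; rewrite pdbar_sqnorm// mulr_sumr.
    by apply: eq_bigr => l _; rewrite mulrA.
  rewrite exchange_big; apply: eq_bigr => k _.
  rewrite (pd_real _ Uz smooth_sqnorm sqnorm_real) pdbar_sqnorm// rmorph_sum mulr_sumr.
  apply: eq_bigr => j _; rewrite rmorphM/= defect_herm//.
  by rewrite mulrA [V z k * _]mulrC.
transitivity (\sum_k \sum_j V z k * ((grad_sqnorm z j)^* * G z k j)).
  apply: eq_bigr => k _.
  rewrite (pd_real _ Uz smooth_sqnorm sqnorm_real) -grad_sqnorm_G// rmorph_sum mulr_sumr.
  by apply: eq_bigr => j _; rewrite rmorphM/= -hG.
rewrite exchange_big; apply: eq_bigr => j _; rewrite /alpha mulr_sumr.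
by apply: eq_bigr => k _; rewrite mulrCA.
Qed.

(** [V_sqnorm] differentiated along d/dz^i, which kills the components of the
    antiholomorphic fields Vbar and Wbar. *)
Lemma pd_V_sqnorm z i : U z ->
  \sum_j (V z j)^* * pd (inl i) (pd (inr j) sqnorm) z =
  \sum_j (grad_sqnorm z j)^* * defect z i j.
Proof.
move=> Uz.
have Sc k : smooth U (fun w => (V w k)^*) by apply: smooth_conj => //; exact: smoothV.
have Sg k : smooth U (fun w => (grad_sqnorm w k)^*).
  by apply: smooth_conj => //; have [] := grad_sqnorm_holomorphic k.
have Su k : smooth U (pd (inr k) sqnorm) by apply: smooth_pd => //; exact: smooth_sqnorm.
have := eq_pd (inl i) oU V_sqnorm Uz.
rewrite (pd_sum oU Uz) => [|k]; last by exact: smoothM.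
rewrite (pd_sum oU Uz) => [|k]; last by apply: smoothM => //; exact: smooth_alpha.
have dVc k : pd (inl i) (fun w => (V w k)^*) z = 0.
  by have /= -> := pd_conj Uz (inl i) (smoothV k); rewrite pdbarV// conjC0.
have dgc k : pd (inl i) (fun w => (grad_sqnorm w k)^*) z = 0.
  have [Sk Hk] := grad_sqnorm_holomorphic k.
  by have /= -> := pd_conj Uz (inl i) Sk; rewrite Hk// conjC0.
move=> H; transitivity (\sum_j pd (inl i) (fun w => (V w j)^* * pd (inr j) sqnorm w) z).
  apply: eq_bigr => j _.
  by rewrite (pdM Uz _ (Sc j) (Su j)) dVc mul0r add0r.
rewrite {}H; apply: eq_bigr => j _.
by rewrite (pdM Uz _ (Sg j) (smooth_alpha j)) dgc mul0r add0r pd_alpha.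
Qed.

(** At the maximum W = - 2 e F V, so by [pd_V_sqnorm] the contribution of |V|^2
    to the Levi form of |V|^2 + e F^2 in the direction V is - 2 e F P(V, Vbar),
    which cancels the term 2 e F V Vbar F; there remains 2 e |V|^4. *)
Lemma local_max_sqnorm z (e : R) : U z -> 0 < e ->
  (exists2 r : R, 0 < r & forall y, `|y| < r ->
    complex.Re (sqnorm (z + y) + e%:C%C * (potential (z + y) * potential (z + y)))
    <= complex.Re (sqnorm z + e%:C%C * (potential z * potential z))) ->
  sqnorm z = 0.
Proof.
move=> Uz e0 mx.
pose Phi w := sqnorm w + e%:C%C * (potential w * potential w).
have Sp := smooth_potential; have Su := smooth_sqnorm.
have Spp : smooth U (fun w => potential w * potential w) by exact: smoothM.
have Sepp : smooth U (fun w => e%:C%C * (potential w * potential w)).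
  by apply: smoothM => //; exact: smooth_cst.
have SPhi : smooth U Phi by exact: smoothD.
have dPhi q w (Uw : U w) : pd (inr q) Phi w =
    pd (inr q) sqnorm w + 2 * e%:C%C * (potential w * alpha w q).
  rewrite /Phi (pdD Uw)// (pdZ Uw)// (pdM Uw)// pdbar_potential//.
  by rewrite [alpha w q * _]mulrC; ring.
have ImPhi w (Uw : U w) : complex.Im (Phi w) = 0.
  have : (Phi w)^* = Phi w.
    rewrite rmorphD rmorphM rmorphM /= sqnorm_real// potential_real//.
    by congr (_ + _ * _); exact: conjc_real.
  by move=> /(congr1 (@complex.Im R)); rewrite cIm_conj; lra.
have crit q : pd (inr q) sqnorm z = - (2 * e%:C%C * potential z) * alpha z q.
  have := max_pd oU Uz SPhi mx (inr q) ImPhi; rewrite dPhi// => /eqP.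
  rewrite addr_eq0 => /eqP ->.
  by move: (potential z) (alpha z q) (e%:C%C) => a b c; ring.
have gradV i : grad_sqnorm z i = - (2 * e%:C%C * potential z) * V z i.
  rewrite -(alpha_inv i Uz) mulr_sumr; apply: eq_bigr => j _.
  by rewrite crit mulrCA.
have := max_levi oU Uz SPhi mx (\row_i V z i).
suff -> : \sum_i \sum_j (\row_i0 V z i0) 0 i * ((\row_i0 V z i0) 0 j)^* *
     pd (inl i) (pd (inr j) Phi) z = (2 * e)%:C%C * (sqnorm z * sqnorm z).
  have := sqnorm_ge0 Uz; rewrite lecE/= => /andP[/eqP im0 re0].
  rewrite cReZ cReM im0 mul0r subr0 pmulr_rle0 ?mulr_gt0// -expr2 => re2.
  apply: complex_ext => //=; apply/eqP.
  by rewrite -sqrf_eq0 eq_le re2 sqr_ge0.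
have ddPhi i j : pd (inl i) (pd (inr j) Phi) z = pd (inl i) (pd (inr j) sqnorm) z
    + 2 * e%:C%C * ((alpha z i)^* * alpha z j + potential z * defect z i j).
  have Sa := smooth_alpha j.
  have Spa : smooth U (fun w => potential w * alpha w j) by exact: smoothM.
  have Suj : smooth U (pd (inr j) sqnorm) by exact: smooth_pd.
  rewrite (eq_pd _ oU (dPhi j) Uz) (pdD Uz)//; last first.
    by apply: smoothM => //; exact: smooth_cst.
  rewrite (pdZ Uz)// (pdM Uz)// pd_alpha//.
  by rewrite (pd_real _ Uz Sp potential_real) pdbar_potential.
have rowV i : (\row_k V z k : 'rV[C]_n) 0 i = V z i by rewrite mxE.
have split3 (X Y Z : 'I_n -> 'I_n -> C) (c d : C) :
    \sum_i \sum_j (X i j + c * (Y i j + d * Z i j)) =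
    \sum_i \sum_j X i j + c * (\sum_i \sum_j Y i j + d * \sum_i \sum_j Z i j).
  rewrite !mulr_sumr -!big_split mulr_sumr -big_split; apply: eq_bigr => i _ /=.
  by rewrite mulr_sumr -big_split mulr_sumr -big_split.
pose b := \sum_i \sum_j V z i * ((V z j)^* * defect z i j).
transitivity (\sum_i \sum_j V z i * ((V z j)^* * pd (inl i) (pd (inr j) sqnorm) z)
   + 2 * e%:C%C * (\sum_i \sum_j (V z i * (alpha z i)^*) * ((V z j)^* * alpha z j)
       + potential z * b)).
  rewrite -split3; apply: eq_bigr => i _; apply: eq_bigr => j _; rewrite !rowV ddPhi.
  move: (pd _ _ z) (alpha z j) (alpha z i)^* (defect z i j) => p q r s.
  move: (V z i) (V z j)^* => t u.
  by move: (potential z) (e%:C%C) => c d; ring.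
have -> : \sum_i \sum_j (V z i * (alpha z i)^*) * ((V z j)^* * alpha z j)
    = sqnorm z * sqnorm z.
  rewrite -big_distrlr/=; congr (_ * _); rewrite -[RHS]sqnorm_real// rmorph_sum.
  by apply: eq_bigr => i _; rewrite rmorphM/= conjCK.
have -> : \sum_i \sum_j V z i * ((V z j)^* * pd (inl i) (pd (inr j) sqnorm) z)
   = - (2 * e%:C%C * potential z) * b.
  rewrite mulr_sumr; apply: eq_bigr => i _; rewrite -mulr_sumr pd_V_sqnorm//.
  rewrite !mulr_sumr; apply: eq_bigr => j _; rewrite gradV !rmorphM rmorphN !rmorphM /=.
  rewrite conj2 potential_real// -[(_%:C%C)^*]/(conjc _) conjc_real.
  move: (potential z) (e%:C%C) (defect z i j) (V z i) (V z j)^* => p q r s t.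
  by ring.
rewrite rmorphM rmorph_nat /=.
by move: (potential z) (e%:C%C) (sqnorm z) b => p q r s; ring.
Qed.

End LocalSoliton.

(** * From charts to the manifold *)

Section Charts.
Variables (R : realType) (n : nat) (X : complexManifold R n).
Local Notation E := (Cn R n).
Local Notation C := R[i].
Implicit Types (a b : chart X) (x : X) (z w : E).

Lemma overlapP a b z : overlap a b z ->
  exists x, [/\ cdom a x, cdom b x, cmap a x = z & transition a b z = cmap b x].
Proof. by move=> [x [ax bx] <-]; exists x; split=> //; rewrite /transition cmapK. Qed.

Lemma overlap_crange a b z : overlap a b z -> crange a z /\ crange b (transition a b z).
Proof. by move=> /overlapP[x [ax bx <- ->]]; split; exists x. Qed.

Lemma transition_continuous a b z : overlap a b z ->
  {for z, continuous (transition a b)}.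
Proof.
move=> abz; have [x [ax bx xz _]] := overlapP abz.
apply: continuous_comp; first by apply: cinv_continuous; exists x.
by rewrite -xz cmapK//; exact: cmap_continuous.
Qed.

Lemma overlap_open a b : open (overlap a b).
Proof.
rewrite openE => z abz; have [x [ax bx xz _]] := overlapP abz.
have ra : crange a z by exists x.
have N1 : nbhs z (crange a) by apply: open_nbhs_nbhs; split=> //; exact: crange_open.
have N2 : nbhs z (cinv a @^-1` cdom b).
  apply: (cinv_continuous ra); rewrite -xz cmapK//.
  by apply: open_nbhs_nbhs; split=> //; exact: cdom_open.
rewrite /interior; apply: filterS (filterI N1 N2) => w [[y ay <-]] /=.
by rewrite cmapK// => By; exists y.
Qed.

(** Glue f to a function on X by choosing a chart around each point; near a
    point this agrees with f read in one fixed chart, hence is continuous. *)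
Lemma scalar_field_max (f : chart X -> E -> R) a0 z0 : compact [set: X] ->
  crange a0 z0 ->
  (forall a z, crange a z -> {for z, continuous (f a)}) ->
  (forall a b z, overlap a b z -> f a z = f b (transition a b z)) ->
  exists a z, crange a z /\ forall b w, crange b w -> f b w <= f a z.
Proof.
move=> cX [x0 ax0 _] cf ff.
have [ch hch] := choice (@cdom_cover R n X).
pose Phi x := f (ch x) (cmap (ch x) x).
have PhiE a x : cdom a x -> Phi x = f a (cmap a x).
  move=> ax; rewrite /Phi (ff (ch x) a); last by exists x.
  by rewrite /transition cmapK.
have cPhi : continuous Phi.
  move=> x; have [ax oa] := (hch x, cdom_open (ch x)).
  have cc : {for x, continuous (f (ch x) \o cmap (ch x))}.
    by apply: continuous_comp; [exact: cmap_continuous|apply: cf; exists x].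
  rewrite /continuous_at (PhiE _ _ ax); apply: cvg_trans cc; apply: near_eq_cvg.
  near=> y; rewrite /= -PhiE//; near: y.
  by apply: open_nbhs_nbhs.
have [|x _ mx] := compact_EVT_max _ cX (continuous_subspaceT cPhi).
  by exists x0.
exists (ch x), (cmap (ch x) x); split; first by exists x.
move=> b w [y By <-]; rewrite -PhiE//; apply: mx; exact: mem_set.
Unshelve. all: by end_near. Qed.

End Charts.

Section Global.
Variables (R : realType) (n : nat) (X : complexManifold R n) (g : hermitianMetric X).
Local Notation E := (Cn R n).
Local Notation C := R[i].
Variable V : vectorField X.
Hypotheses (kg : kahler g) (hV : holomorphic_vector_field V) (eg : extremal g).
Hypothesis sol : eq_form2 (sub_form2 (ricci_form g) (kahler_form g))
                          (lie_form2 V (kahler_form g)).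
Implicit Types (a b : chart X) (z w : E).

Let kahler_const : C := 'i / (2 * pi)%:C%C.

Lemma kahler_const_neq0 : kahler_const != 0.
Proof.
rewrite mulf_neq0 ?neq0Ci// invr_eq0 eq_complex /= eqxx andbT.
by rewrite mulf_neq0 ?gt_eqF ?pi_gt0.
Qed.

Lemma open_crange a : open (crange a). Proof. exact: crange_open. Qed.
Let oU := open_crange.

Lemma smoothG a i j : smooth (crange a) (fun z => g a z i j).
Proof. exact: metric_smooth. Qed.

Lemma holomorphicV a i : holomorphic (crange a) (fun z => V a z i).
Proof. by case: hV => [hV1 _]; exact: hV1. Qed.

Lemma kahler_symmetric a z : crange a z -> forall i j k,
  pd (inl k) (fun w => g a w i j) z = pd (inl i) (fun w => g a w k j) z.
Proof.
move=> Uz i j k; have := kg Uz (inl k) (inl i) (inr j).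
rewrite /kahler_form /form11 /= -/kahler_const pd_cst addr0.
have S p q : smooth (crange a) (fun w => kahler_const * g a w p q).
  by apply: smoothM => //; [exact: smooth_cst|exact: smoothG].
rewrite (pdN Uz _ (S _ _)) !(pdZ Uz _ _ (smoothG a _ _)).
by move=> /eqP; rewrite subr_eq0 => /eqP/(mulfI kahler_const_neq0).
Qed.

Lemma soliton_local a z : crange a z -> forall i j,
  Ric (g a) z i j - g a z i j = \sum_k (V a z k * pd (inl k) (fun w => g a w i j) z
    + pd (inl i) (fun w => V a w k) z * g a z k j).
Proof.
move=> Uz i j; have := sol Uz (inl i) (inr j).
rewrite /sub_form2 /lie_form2 big_sumType /= -/kahler_const.
rewrite [X in _ = _ + X]big1 => [|k _]; last first.
  by rewrite !pd_cst !mul0r !addr0.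
rewrite addr0 -mulrBr => H; apply: (mulfI kahler_const_neq0); rewrite [LHS]H mulr_sumr.
apply: eq_bigr => k _; rewrite (pdZ Uz _ _ (smoothG a _ _)) mulr0 addr0.
move: (pd _ _ _) (pd _ _ _) (V a z k) (g a z k j) => p q r s.
by ring.
Qed.

Lemma extremal_local a i : holomorphic (crange a)
  (fun z => \sum_j invmx (g a z) j i * pd (inr j) (scal (g a)) z).
Proof. by case: eg => [e1 _]; exact: e1. Qed.

(** The transpose of the usual Jacobian matrix, because the components of
    vectors are arranged in rows. *)
Definition jac a b z : 'M[C]_n := \matrix_(i, k) Defs.jacobian a b z (inl i) (inl k).
Definition rowV a z : 'rV[C]_n := \row_i V a z i.

Lemma metric_transition a b z : overlap a b z ->
  g a z = jac a b z *m g b (transition a b z) *m map_mx Num.conj (jac a b z)^T.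
Proof.
move=> abz; apply/matrixP => i j; rewrite (metric_compat g abz).
rewrite exchange_big !mxE; apply: eq_bigr => l _.
rewrite !mxE mulr_suml; apply: eq_bigr => k _; rewrite !mxE.
by rewrite mulrAC.
Qed.

Lemma V_transition a b z : overlap a b z ->
  rowV b (transition a b z) = rowV a z *m jac a b z.
Proof.
move=> abz; apply/rowP => k; case: hV => [_ hV2].
rewrite mxE (hV2 _ _ _ abz) mxE; apply: eq_bigr => i _.
by rewrite !mxE mulrC.
Qed.

Lemma alpha_row a z j : alpha (g a) (V a) z j = (rowV a z *m g a z) 0 j.
Proof. by rewrite mxE; apply: eq_bigr => k _; rewrite mxE. Qed.

Lemma alpha_transition a b z j : overlap a b z ->
  alpha (g a) (V a) z j = \sum_l (Defs.jacobian a b z (inl j) (inl l))^*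
     * alpha (g b) (V b) (transition a b z) l.
Proof.
move=> abz; rewrite alpha_row (metric_transition abz) !mulmxA -V_transition// mxE.
by apply: eq_bigr => l _; rewrite alpha_row mulrC !mxE.
Qed.

Lemma sqnorm_mx a z : crange a z -> sqnorm (g a) (V a) z =
  (rowV a z *m g a z *m map_mx Num.conj (rowV a z)^T) 0 0.
Proof.
move=> Uz; rewrite (sqnorm_form (V a) (@metric_hermitian _ _ _ g a) Uz).
rewrite -hermitian_form_mx.
by apply: eq_bigr => i _; apply: eq_bigr => j _; rewrite !mxE.
Qed.

Lemma sqnorm_transition a b z : overlap a b z ->
  sqnorm (g a) (V a) z = sqnorm (g b) (V b) (transition a b z).
Proof.
move=> abz; have [az bz] := overlap_crange abz.
rewrite !sqnorm_mx// V_transition// (metric_transition abz) trmx_mul map_mxM.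
by rewrite !mulmxA.
Qed.

(** Reading P as d_i alpha_j avoids transforming the second derivatives of
    log det g: alpha transforms by the conjugate Jacobian matrix, whose entries
    are antiholomorphic and hence constants for d/dz^i. *)
Lemma defect_transition a b z : overlap a b z ->
  defect (g a) z = jac a b z *m defect (g b) (transition a b z)
    *m map_mx Num.conj (jac a b z)^T.
Proof.
move=> abz; have [az bz] := overlap_crange abz.
have oab := @overlap_open R n X a b.
pose tau l w := zcoord (inl l) (transition a b w).
have [stau htau] : (forall l, smooth (overlap a b) (tau l)) /\
    (forall l j w, overlap a b w -> pd (inr j) (tau l) w = 0).
  by split=> l; have [] := transition_holomorphic a b l.
have Sj j l : smooth (overlap a b) (pd (inl j) (tau l)) by exact: smooth_pd.
have Sjc j l : smooth (overlap a b) (fun w => (pd (inl j) (tau l) w)^*).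
  exact: smooth_conj.
have Sb l := smooth_alpha (@oU b) (@smoothG b) (holomorphicV b) l.
have UV w : overlap a b w -> crange b (transition a b w).
  by move=> /overlap_crange[].
have cT w : overlap a b w -> {for w, continuous (transition a b)}.
  exact: transition_continuous.
have ST l : smooth (overlap a b) (fun w => alpha (g b) (V b) (transition a b w) l).
  exact: (smooth_comp oab (@oU b) UV cT stau (Sb l)).
apply/matrixP => i j.
rewrite -(pd_alpha (@oU a) (@smoothG a) (holomorphicV a) (@kahler_symmetric a) (@soliton_local a)
  i j az).
have aE w : overlap a b w -> alpha (g a) (V a) w j =
    \sum_l (pd (inl j) (tau l) w)^* * alpha (g b) (V b) (transition a b w) l.
  exact: alpha_transition.
rewrite (eq_pd (inl i) oab aE abz) (pd_sum oab abz) => [|l]; last first.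
  exact: smoothM.
rewrite [RHS]mxE; apply: eq_bigr => l _.
rewrite (pdM abz _ (Sjc j l) (ST l)).
have -> : pd (inl i) (fun w => (pd (inl j) (tau l) w)^*) z = 0.
  have /= -> := pd_conj abz (inl i) (Sj j l).
  rewrite (pd_swap oab abz (inr i) (inl j) (stau l)).
  rewrite (@eq_pd R n _ _ (fun=> 0) _ z oab) ?pd_cst ?conjC0// => w abw.
  exact: htau.
have -> : map_mx Num.conj (jac a b z)^T l j = (pd (inl j) (tau l) z)^*.
  by rewrite !mxE.
rewrite mul0r add0r mulrC; congr (_ * _); rewrite [RHS]mxE.
have := pd_comp (@oU b) UV cT stau (inl i) abz (Sb l); rewrite /= => ->.
apply: eq_bigr => k _; rewrite -/(tau k) htau// conjC0 mul0r addr0.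
congr (_ * _); first by rewrite mxE.
exact: (pd_alpha (@oU b) (@smoothG b) (holomorphicV b) (@kahler_symmetric b) (@soliton_local b)
  k l bz).
Qed.

Lemma potential_transition a b z : overlap a b z ->
  potential (g a) (V a) z = potential (g b) (V b) (transition a b z).
Proof.
move=> abz; have [az bz] := overlap_crange abz.
have ug := unitG (@metric_hermitian _ _ _ g a) (@metric_posdef _ _ _ g a) az.
rewrite /potential /trdefect (sqnorm_transition abz).
by rewrite (mxtrace_congr (metric_transition abz) (defect_transition abz) ug).
Qed.

Hypothesis cX : compact [set: X].

(** Otherwise u = |V|^2 is positive at some z.  With M = max F^2 and
    e = u(z) / (M + 1), the maximum of u + e F^2 is attained where u = 0, so it
    is at most e M < u(z), a contradiction. *)
Lemma V_eq0 a z i : crange a z -> V a z i = 0.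
Proof.
pose u b w := sqnorm (g b) (V b) w; pose F b w := potential (g b) (V b) w.
have Su b : smooth (crange b) (u b).
  exact: (smooth_sqnorm (@oU b) (@smoothG b) (holomorphicV b)).
have SF b : smooth (crange b) (F b).
  exact: (smooth_potential (@oU b) (@smoothG b) (@metric_hermitian _ _ _ g b)
    (@metric_posdef _ _ _ g b) (holomorphicV b) (@soliton_local b)).
have SFF b : smooth (crange b) (fun w => F b w * F b w) by exact: smoothM.
have u0 b w (bw : crange b w) : 0 <= u b w.
  exact: (sqnorm_ge0 (V b) (@metric_hermitian _ _ _ g b) (@metric_posdef _ _ _ g b)).
have FF0 b w (bw : crange b w) : 0 <= complex.Re (F b w * F b w).
  have := potential_real (V b) (@oU b) (@smoothG b) (@metric_hermitian _ _ _ g b)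
    (@metric_posdef _ _ _ g b) bw.
  rewrite -/(F b w) => /(congr1 (@complex.Im R)); rewrite cIm_conj => im0.
  have {}im0 : complex.Im (F b w) = 0 by lra.
  by rewrite cReM im0 mul0r subr0 -expr2 sqr_ge0.
have cont f b w : smooth (crange b) f -> crange b w ->
    {for w, continuous (fun y => complex.Re (f y))}.
  by move=> Sf bw; have [C0 _] := Sf 0%N; exact: (Ck_continuous C0 bw).
move=> az; suff : u a z = 0.
  exact: (sqnorm_eq0 (@metric_hermitian _ _ _ g a) (@metric_posdef _ _ _ g a) i az).
have [b [w [bw maxF]]] := @scalar_field_max R n X
  (fun b w => complex.Re (F b w * F b w)) a z cX az
  (fun b w => cont _ b w (SFF b))
  (fun b c w bcw => congr1 (fun q => complex.Re (q * q)) (potential_transition bcw)).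
set M := complex.Re (F b w * F b w) in maxF.
have M0 : 0 <= M by exact: FF0.
have [//|uz0] := eqVneq (u a z) 0.
have uz : 0 < complex.Re (u a z).
  have : 0 < u a z by rewrite lt0r uz0 u0.
  by rewrite ltcE => /andP[].
pose e := complex.Re (u a z) / (M + 1).
have e0 : 0 < e by rewrite divr_gt0// ltr_wpDl.
pose Phi c y := complex.Re (u c y + e%:C%C * (F c y * F c y)).
have SPhi c : smooth (crange c) (fun y => u c y + e%:C%C * (F c y * F c y)).
  by apply: smoothD => //; apply: smoothM => //; exact: smooth_cst.
have [c [y [cy maxPhi]]] := @scalar_field_max R n X Phi a z cX az
  (fun b w => cont _ b w (SPhi b))
  (fun b c w bcw => congr2 (fun p q => complex.Re (p + e%:C%C * (q * q)))
     (sqnorm_transition bcw) (potential_transition bcw)).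
have uy0 : u c y = 0.
  apply: (local_max_sqnorm (@oU c) (@smoothG c) (@metric_hermitian _ _ _ g c)
    (@metric_posdef _ _ _ g c) (holomorphicV c) (@kahler_symmetric c) (@soliton_local c)
    (@extremal_local c) cy e0).
  have [r r0 yr] := open_dist (@oU c) cy.
  by exists r => // v /yr cv; exact: maxPhi.
have := maxPhi a z az; rewrite /Phi uy0 add0r cReD !cReZ.
rewrite leNgt => /negP[].
apply: (@le_lt_trans _ _ (e * M)); first by rewrite ler_pM2l// maxF.
apply: (@lt_le_trans _ _ (complex.Re (u a z))); last first.
  by rewrite lerDl mulr_ge0 ?FF0// ltW.
by rewrite /e mulrAC ltr_pdivrMr ?ltr_wpDl// ltr_pM2l// ltrDl.
Qed.

Lemma einstein : kahler_einstein g.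
Proof.
move=> a z az.
have RG i j : ricci_mx g a z i j = g a z i j.
  apply/eqP; rewrite -subr_eq0; apply/eqP; rewrite [LHS](soliton_local az).
  rewrite big1// => k _; rewrite V_eq0// mul0r add0r.
  rewrite (@eq_pd R n _ _ (fun=> 0) _ z (@oU a)) ?pd_cst ?mul0r// => w aw.
  exact: V_eq0.
by move=> [i|i] [j|j] //=; rewrite RG.
Qed.

End Global.

Theorem theorem1p1 (R : realType) (n : nat) (X : complexManifold R n)
    (g : hermitianMetric X) :
  fano X -> kahler g -> extremal g -> kahler_ricci_soliton g ->
  kahler_einstein g.
Proof.
by move=> [cX _ _] kg eg [V hV sol]; exact: (einstein kg hV eg sol cX).
Qed.
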